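(* Let $t_0=\max\{512e^2B^2\log N,1\}$. The algorithm ${\sf CP}(\phi_{\mathrm{NH}},[0,\infty))$ with initial time $t_0$, where $\phi_{\mathrm{NH}}(y,t)=t^{-1/2}\exp(y^2/(2t))$, run on the experts game with $N$ experts and loss range bound $B>0$, returns $V_T$ such that for all $\epsilon\in(0,1)$ and all $T\ge1$, $$\mathrm{Regret}_\epsilon(T)\le\sqrt{(t_0+2V_T)\big(\log(t_0+2V_T)+2\log(1/\epsilon)\big)}.$$
   Context: Experts game: $N\ge1$ experts and a constant $B>0$. In each round $j=1,2,\dots$ the player chooses $\boldsymbol p_j$ in the probability simplex $\Delta^{N-1}$, then nature reveals $\boldsymbol\ell_j\in\mathbb{R}^N$ with $\max_{i,i'}|\ell_{j,i}-\ell_{j,i'}|\le B$. The instantaneous regret is $\Delta x_{j,i}=\langle \boldsymbol p_j,\boldsymbol\ell_j\rangle-\ell_{j,i}$ and the regret vector is $\boldsymbol x_j=\sum_{k\le j}\Delta\boldsymbol x_k$ ($\boldsymbol x_0=\boldsymbol 0$). For $\epsilon\in(0,1]$, $\mathrm{Regret}_\epsilon(T)=x_{T,(\lfloor N\epsilon\rfloor)}$, the $\lfloor N\epsilon\rfloor$-th largest coordinate of $\boldsymbol x_T$. For a potential $\phi(y,t)$ and domain $\mathcal D\subseteq\mathbb{R}$ (an interval) with Euclidean projection $\Pi_{\mathcal D}$ applied coordinatewise, let $\Phi(\boldsymbol x,t)=\sum_{i=1}^N\phi(x_i,t)$. Algorithm ${\sf CP}(\phi,\mathcal D)$ with initial time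 $t_0$: set $\boldsymbol x_0=\boldsymbol0$, $\tilde{\boldsymbol x}_0=\Pi_{\mathcal D}(\boldsymbol x_0)$, $V_0=0$. For $j=1,\dots,T$: play $p_{j,i}\propto\partial_x\phi(\tilde x_{j-1,i},t_{j-1})$ (arbitrary $\boldsymbol p_j$ if all these are zero); observe $\boldsymbol\ell_j$; set $\boldsymbol x_j=\boldsymbol x_{j-1}+\Delta\boldsymbol x_j$, $\tilde{\boldsymbol x}_j=\Pi_{\mathcal D}(\boldsymbol x_j)$; find $\Delta t_j\ge0$ with $\Phi(\tilde{\boldsymbol x}_j,t_{j-1}+\Delta t_j)=\Phi(\tilde{\boldsymbol x}_{j-1},t_{j-1})$ and set $t_j=t_{j-1}+\Delta t_j$; set $V_j=V_{j-1}+\mathbb{E}_{i\sim\boldsymbol q_j}[\Delta x_{j,i}^2]$ where $q_{j,i}\propto\partial_{xx}\phi(\tilde x_{j-1,i},t_{j-1})$. Return $V_T$. *)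

(* Defs.v *)
From HB Require Import structures.
From mathcomp Require Import all_boot all_order all_algebra.
From mathcomp Require Import all_classical all_reals all_analysis.
Set Implicit Arguments. Unset Strict Implicit. Unset Printing Implicit Defensive.
Import Order.TTheory GRing.Theory Num.Theory.
Local Open Scope ring_scope.

Section Defs.
Variable R : realType.

Definition phiNH (y t : R) : R := (Num.sqrt t)^-1 * expR (y ^+ 2 / (2 * t)).

Definition dx_phi (phi : R -> R -> R) (y t : R) : R :=
  derive1 (fun z => phi z t) y.
Definition dxx_phi (phi : R -> R -> R) (y t : R) : R :=
  derive1 (fun z => derive1 (fun w => phi w t) z) y.

Definition proj_nonneg (x : R) : R := Num.max x 0.

Definition in_simplex (N : nat) (p : 'I_N -> R) : Prop :=
  (forall i, 0 <= p i) /\ \sum_(i < N) p i = 1.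

(* A complete run of CP(phi, D) (D given by its projection proj) with initial
   time t0 against an arbitrary (possibly adaptive) loss sequence l with range
   bound B.  Indices: round j+1 uses the state at time j.
   p j.+1 : play of round j+1, l j.+1 : loss of round j+1,
   x j : regret vector after j rounds, t j, V j as in the algorithm. *)
Definition CP_run (phi : R -> R -> R) (proj : R -> R) (N : nat) (B t0 : R)
    (p l x : nat -> 'I_N -> R) (t V : nat -> R) : Prop :=
  [/\ (forall i, x 0%N i = 0), t 0%N = t0, V 0%N = 0 &
  forall j : nat,
    let w  := fun i => dx_phi phi (proj (x j i)) (t j) in
    let w2 := fun i => dxx_phi phi (proj (x j i)) (t j) in
    let dx := fun i => \sum_(k < N) p j.+1 k * l j.+1 k - l j.+1 i in
    [/\
        (in_simplex (p j.+1) /\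
        ((exists i, w i != 0) -> exists c : R, forall i, p j.+1 i = c * w i)),
        (forall i i', `|l j.+1 i - l j.+1 i'| <= B),
        (forall i, x j.+1 i = x j i + dx i),
        (t j <= t j.+1 /\
          \sum_(i < N) phi (proj (x j.+1 i)) (t j.+1)
          = \sum_(i < N) phi (proj (x j i)) (t j)) &
        V j.+1 = V j + (\sum_(i < N) w2 i * dx i ^+ 2) / (\sum_(i < N) w2 i)]].

(* k-th largest coordinate of a vector (k counted from 1); by convention the
   0-th largest is the largest. *)
Definition kth_largest (N : nat) (k : nat) (v : 'I_N -> R) : R :=
  nth 0 (sort (fun a b : R => b <= a) [seq v i | i <- enum 'I_N]) k.-1.

Definition regret_eps (N : nat) (x : nat -> 'I_N -> R) (T : nat) (eps : R) : R :=
  kth_largest `|Num.floor (N%:R * eps)|%N (x T).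

End Defs.

(* Main.v *)
Require Import Defs.
From HB Require Import structures.
From mathcomp Require Import all_boot all_order all_algebra.
From mathcomp Require Import all_classical all_reals all_analysis.
From mathcomp Require Import ring lra.
Import Order.TTheory GRing.Theory Num.Theory.
Import numFieldNormedType.Exports.
Local Open Scope ring_scope.

(** With e_i = exp(x~_i^2 / 2t) and s = sqrt (t / t0), conservation of the
    potential reads sum_i e_i = N s, and a quantile regret v > 0 is attained by
    k = max(|_N eps_|, 1) coordinates, so v^2 <= 2 t ln (1 + (N / k) (s - 1)).
    It remains to bound t by V.  Since phi solves the backward heat equation and
    the play makes the first-order term vanish, each round has dt = dV up to
    third-order terms; the choice of t0 makes these a small relative error, which
    gives t <= t0 + 1.1 V.

    This absorbs the loss from 1/eps to N/k, except for N = 2, k = 1, V -> 0, where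
    the claimed bound is tight to first order.  For N = 2 and V <= t0 / 4 a
    second-order estimate is needed: sqrt (t / t0) <= 1 + V/(2 t0) + (V/t0)^2 / 16. *)

(** The constant 1.1 comes from one chain. Since [512 e^2 >= 3584], the first-order change
    [u = X D / t] of an exponent satisfies [u^2 <= 1/1200], so [|u| < 0.03]. The quadratic gain from
    a move is then at most 1.03 times its ideal value, the loss from advancing time at least 0.94
    times, and [0.94 * 1.1 > 1.03]. The claim has [2 V] where the time has [1.1 V], and this gap
    pays for rounding [N eps] down to [K]. For [N = 2], [K = 1] it cannot: [N / (K + 1) = 1]
    contributes no logarithm, and in units of [t0] the claim becomes [s^2 ln (2 s - 1) <= (1 + 2 V)
    / 2 * ln (1 + 2 V)]. The right side is [V] to first order, and so is the left side when
    [s^2 = 1 + V]; with [s^2 = 1 + 1.1 V] it is [1.1 V]. Hence no fixed relative error in the time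
    is affordable there. For two experts, however, [|u|] is bounded by [s - 1] plus a multiple of
    the increment [d] of [V]. The error then shrinks as [s] tends to 1, and what remains fits into
    terms of second order. *)

(** * Elementary bounds on exp and ln *)

Lemma expR_ge_taylor3 (R : realType) (x : R) :
  1 + x + x ^+ 2 / 2 + x ^+ 3 / 6 <= expR x.
Proof.
(* [g] increases up to 0 and decreases afterwards, so it peaks at [g 0 = 1]. The bound thus holds
   for both signs of [x] and yields upper bounds on exp by inversion. *)
pose g (z : R) := (1 + z + z ^+ 2 / 2 + z ^+ 3 / 6) * expR (- z).
have dg (z : R) : is_derive z 1 g (- (z ^+ 3 / 6) * expR (- z)).
  rewrite /g.
  apply: is_derive_eq.
  rewrite /GRing.scale /=; field; rewrite ?pnatr_eq0 //.
have cg : continuous g.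
  by move=> w; apply/differentiable_continuous/derivable1_diffP; case: (dg w).
have eg (z : R) : (g^`())%classic z = - (z ^+ 3 / 6) * expR (- z).
  by rewrite derive1E; case: (dg z).
suff g1 : g x <= 1.
  move: g1; rewrite /g -(ler_pM2r (expR_gt0 x)) mul1r -mulrA -expRD addNr expR0.
  by rewrite mulr1.
have g0 : g 0 = 1 by rewrite /g oppr0 expR0 !expr0n /= !mul0r !addr0 mulr1.
rewrite -g0.
have [x0|x0] := leP x 0.
- apply: (@ger0_derive1_ndecrNy _ g 0) => //.
  + move=> z; rewrite in_itv /= => z0; rewrite eg mulr_ge0 ?expR_ge0//.
    by nra.
  + exact: continuous_subspaceT.
- apply: (@ler0_derive1_nincry _ g 0) => //; last exact: ltW.
  + move=> z; rewrite in_itv /= andbT => z0; rewrite eg mulr_le0_ge0 ?expR_ge0//.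
    by nra.
  + exact: continuous_subspaceT.
Qed.

Lemma expR_le_taylor2 (R : realType) (x : R) : 0 <= x ->
  expR (- x) <= 1 - x + x ^+ 2 / 2.
Proof.
move=> x0; rewrite expRN -[leLHS]mul1r ler_pdivrMr ?expR_gt0//.
have := expR_ge_taylor3 _ x.
have: 0 <= x ^+ 3 by exact: exprn_ge0.
have p0 : 0 < 1 - x + x ^+ 2 / 2 by nra.
move=> x3 /(ler_wpM2l (ltW p0)); apply: le_trans.
by nra.
Qed.

(** With [L = ln y] this is [L <= sinh L]. For a coordinate with [c = X^2 / t = 2 ln e] it reads
    [e c <= e^2 - 1]. *)
Lemma ln_le_sinh (R : realType) (y : R) : 1 <= y -> y * ln y <= (y ^+ 2 - 1) / 2.
Proof.
move=> y1; have y0 : 0 < y by lra.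
have L0 : 0 <= ln y by exact: ln_ge0.
have := expR_ge_taylor3 _ (ln y); have := expR_le_taylor2 _ _ L0.
rewrite expRN lnK ?posrE// => h1 h2.
have L3 : 0 <= ln y ^+ 3 by exact: exprn_ge0.
have : 2 * ln y <= y - y^-1 by lra.
move/(ler_wpM2l (ltW y0)); rewrite mulrBr divff ?gt_eqF//.
lra.
Qed.

Lemma ln2_ge (R : realType) : 2 / 3 <= ln (2 : R).
Proof.
rewrite -ler_expR lnK ?posrE//.
have := expR_ge_taylor3 _ (- (2 / 3) : R).
rewrite expRN => h.
have e0 := expR_gt0 (2 / 3 : R).
have ee : expR (2 / 3 : R) * (expR (2 / 3 : R))^-1 = 1 by rewrite divff ?gt_eqF.
nra.
Qed.

Lemma expR1_sqr_ge (R : realType) : 7 <= expR (1 : R) ^+ 2.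
Proof. have := expR_ge_taylor3 _ (1 : R); nra. Qed.

Lemma expR_chord (R : realType) (r z : R) : 0 <= r <= 1 ->
  expR (r * z) <= 1 + r * (expR z - 1).
Proof.
move=> /andP[r0 r1].
have := convex_expR (Itv01 r0 r1) z 0.
rewrite !convRE /= /unstable.onem expR0 mulr0 addr0 mulr1 => h.
by apply: (le_trans h); rewrite le_eqVlt; apply/orP; left; apply/eqP; ring.
Qed.

Lemma bernoulli_ln (R : realType) (r y : R) : 1 <= r -> 0 <= y ->
  ln (1 + r * y) <= r * ln (1 + y).
Proof.
move=> r1 y0; have r0 : 0 < r by lra.
have p0 : 0 < 1 + r * y by nra.
have q0 : 0 < 1 + y by lra.
have ri : 0 <= r^-1 <= 1 by rewrite invr_ge0 (ltW r0) invf_le1.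
have := expR_chord _ r^-1 (ln (1 + r * y)) ri.
rewrite lnK ?posrE// [1 + r * y - 1]addrAC subrr add0r mulrA mulVf ?gt_eqF// mul1r.
rewrite -[X in _ <= X]lnK ?posrE// ler_expR -(ler_pM2l r0) mulrA.
by rewrite divff ?gt_eqF// mul1r.
Qed.

(** The right-hand side times the cubic Taylor lower bound of [exp (- a)] is 1 plus [|a|^3] times a
    factor. For [a > 0] this factor starts with [9/50 - 1/6 = 1/75], which outweighs its other terms
    on the given range. *)
Lemma expR_le_cubic (R : realType) (a : R) : `|a| <= 3 / 100 ->
  expR a <= 1 + a + a ^+ 2 / 2 + 9 / 50 * `|a| ^+ 3.
Proof.
move=> ha; have := ha; rewrite ler_norml => /andP[a1 a2].
have h := expR_ge_taylor3 _ (- a).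
pose Q := 1 - a + a ^+ 2 / 2 - a ^+ 3 / 6.
have hQ : Q <= expR (- a).
  by apply: le_trans h; rewrite /Q le_eqVlt; apply/orP; left; apply/eqP; field.
have Q0 : 0 < Q by rewrite /Q; nra.
have : expR a <= Q^-1.
  by rewrite -[a in expR a]opprK expRN lef_pV2 ?posrE ?expR_gt0.
move=> /le_trans; apply.
rewrite -[leLHS]mul1r ler_pdivrMr// /Q.
clear h Q hQ Q0.
have [a0|a0] := leP 0 a.
  rewrite ger0_norm//.
  have -> : (1 + a + a ^+ 2 / 2 + 9 / 50 * a ^+ 3) *
     (1 - a + a ^+ 2 / 2 - a ^+ 3 / 6) =
     1 + a ^+ 3 *
      (1 / 75 + a * (-(29 / 300)) + a ^+ 2 * (1 / 150) - a ^+ 3 * (3 / 100)).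
    by field.
  have a3 : 0 <= a ^+ 3 by exact: exprn_ge0.
  have a31 : a ^+ 3 <= 1 / 10 by rewrite !exprS expr0 mulr1; nra.
  have p0 : 0 <= 1 / 75 + a * (-(29 / 300)) + a ^+ 2 * (1 / 150) - a ^+ 3 * (3 / 100) by nra.
  by rewrite lerDl; apply: mulr_ge0.
rewrite ltr0_norm//.
have [b ab] : exists b, a = - b by exists (- a); rewrite opprK.
have b0 : 0 <= b by lra.
rewrite ab.
have -> : (1 + - b + (- b) ^+ 2 / 2 + 9 / 50 * (- - b) ^+ 3) *
     (1 - - b + (- b) ^+ 2 / 2 - (- b) ^+ 3 / 6) =
     1 + b ^+ 3 *
      (26 / 75 + b * (79 / 300) + b ^+ 2 * (13 / 75) + b ^+ 3 * (3 / 100)).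
  by field.
have b3 : 0 <= b ^+ 3 by exact: exprn_ge0.
have p0 : 0 <= 26 / 75 + b * (79 / 300) + b ^+ 2 * (13 / 75) + b ^+ 3 * (3 / 100) by nra.
by rewrite lerDl; apply: mulr_ge0.
Qed.

(* Here u = X D / t, w = D^2 / t and c = X^2 / t for a move D of a coordinate at X. *)
Lemma expR_step_le (R : realType) (u w c : R) : 0 <= c -> 0 <= w <= 1 / 2000 ->
  u ^+ 2 = c * w -> c * w <= 1 / 1200 ->
  expR (u + w / 2) <=
  1 + u + w / 2 * (1 + c) * (1 + (51 / 50 * `|u| + 13 / 50 * w)).
Proof.
move=> c0 /andP[w0 w1] uE cw.
have a2 : `|u| ^+ 2 <= 1 / 1200 by rewrite -normrX uE ger0_norm ?mulr_ge0.
have a0 : 0 <= `|u| by [].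
have fa := ler_normD u (w / 2); rewrite [`|w / 2|]ger0_norm ?divr_ge0// in fa.
have ua := ler_norm u.
have [a aE] : exists a : R, `|u| = a by exists `|u|.
rewrite aE in a2 a0 fa ua *; clear aE.
have a1 : a <= 29 / 1000 by nra.
have f1 : `|u + w / 2| <= 3 / 100 by lra.
apply: (le_trans (expR_le_cubic _ _ f1)).
have n0 : 0 <= `|u + w / 2| by [].
have f3 : (u + w / 2) ^+ 2 = w * (c + u + w / 4).
  by rewrite sqrrD uE; field.
have f2 : `|u + w / 2| ^+ 2 = w * (c + u + w / 4).
  by rewrite -normrX ger0_norm ?sqr_ge0.
rewrite f3 exprSr f2.
have [f fE] : exists f : R, `|u + w / 2| = f by exists `|u + w / 2|.
rewrite fE in fa f1 n0 *; clear fE f2 f3 uE a2.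
have cf : c * f <= c * (a + w / 2) by exact: ler_wpM2l.
have gf : (a + w / 4) * f <= (a + w / 4) * (3 / 100) by apply: ler_wpM2l => //; lra.
have uf : (u + w / 4) * f <= (a + w / 4) * f by apply: ler_wpM2r => //; lra.
have ca : 0 <= c * a by exact: mulr_ge0.
have cw0 : 0 <= c * w by exact: mulr_ge0.
have key : (c + u + w / 4) * (1 + 9 / 25 * f) <= c + (1 + c) * (51 / 50 * a + 13 / 50 * w).
  have -> : (c + u + w / 4) * (1 + 9 / 25 * f) =
     c + u + w / 4 + 9 / 25 * (c * f) + 9 / 25 * ((u + w / 4) * f) by field.
  have -> : c + (1 + c) * (51 / 50 * a + 13 / 50 * w) =
     c + 51 / 50 * a + 13 / 50 * w + 51 / 50 * (c * a) + 13 / 50 * (c * w) by field.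
  lra.
clear cf gf uf ca cw0 fa f1 n0.
have w20 : 0 <= w / 2 by lra.
have := ler_wpM2l w20 key.
clear; lra.
Qed.

(* With z = c / 2 + u + w / 2 = (X + D)^2 / 2t, going from time t to t (1 + h) scales
   exp z exactly by exp (- z h / (1 + h)), and the prefactor t^(-1/2) by
   (1 + h)^(-1/2) <= exp (- h / (2 (1 + h))). *)
Lemma expR_time_le (R : realType) (u w c h : R) : 0 <= c -> 0 <= w <= 1 / 2000 ->
  u ^+ 2 = c * w -> c * w <= 1 / 1200 -> 0 <= h <= 1 / 1800 -> c * h <= 1 / 1000 ->
  expR (u + w / 2 - (1 / 2 + (c / 2 + u + w / 2)) * (h / (1 + h))) <=
  1 + u + (1 + c) / 2 * (103 / 100 * w - 94 / 100 * h).
Proof.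
move=> c0 hw uE cw /andP[h0 h1] ch.
have := hw => /andP[w0 w1].
have a2 : `|u| ^+ 2 <= 1 / 1200 by rewrite -normrX uE ger0_norm ?mulr_ge0.
have a0 : 0 <= `|u| by [].
have c1 : 0 <= 112 / 10000 * (1 + c) by clear -c0; lra.
(* [u^2 = c w <= c / 2000] and [c <= (1 + c)^2 / 4]; 0.0112 is just above [1 / (2 sqrt 2000)]. *)
have a3 : `|u| <= 112 / 10000 * (1 + c).
  rewrite -(@ler_pXn2r _ 2) ?nnegrE//.
  rewrite -normrX uE ger0_norm ?mulr_ge0//.
  have : c * w <= c * (1 / 2000) by exact: ler_wpM2l.
  have := sqr_ge0 (1 - c); clear -c0; nra.
have hs := expR_step_le _ _ _ _ c0 hw uE cw.
have ua := ler_norm u; have ub := ler_norm (- u); rewrite normrN in ub.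
have [a aE] : exists a : R, `|u| = a by exists `|u|.
rewrite aE in a2 a0 a3 hs ua ub; clear aE uE.
have a1 : a <= 29 / 1000 by clear -a2 a0; nra.
clear a2.
have hs' : expR (u + w / 2) <= 1 + u + w / 2 * (1 + c) * (103 / 100).
  apply: (le_trans hs); rewrite lerD2l; apply: ler_wpM2l; last by clear -a1 w1; lra.
  by apply: mulr_ge0; [clear -w0|clear -c0]; lra.
have e1 : 971 / 1000 <= expR (u + w / 2).
  by apply: le_trans (expR_ge1Dx _); clear -ub a1 w0; lra.
set k := h / (1 + h).
have [kE k0] : k * (1 + h) = h /\ 0 <= k.
  split; last by rewrite /k divr_ge0//; clear -h0; lra.
  by rewrite /k -mulrA mulVf ?mulr1// gt_eqF//; clear -h0; lra.
have [m mE] : exists m, 1 / 2 + (c / 2 + u + w / 2) = m by eexists.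
have m1 : 4888 / 10000 * (1 + c) <= m by rewrite -mE; clear -ub a3 w0; lra.
have m2 : m <= (1 + c) / 2 + 3 / 100 by rewrite -mE; clear -ua a1 w1; lra.
rewrite mE; clear mE.
move: k kE k0 => k kE k0.
have kh : k <= h by clear -kE k0 h0; nra.
have kh' : 999 / 1000 * h <= k by clear -kE k0 h0 h1 kh; nra.
have m0 : 0 <= m by clear -c0 m1; lra.
have [b bE] : exists b, m * k = b by eexists.
have b0 : 0 <= b by rewrite -bE; exact: mulr_ge0.
have b1 : b <= 2 / 1000.
  have : m * k <= m * h by exact: ler_wpM2l.
  have : m * h <= ((1 + c) / 2 + 3 / 100) * h by exact: ler_wpM2r.
  by rewrite bE; clear -ch h1; lra.
have hb : expR (- b) <= 1 - b * (999 / 1000).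
  by apply: (le_trans (expR_le_taylor2 _ _ b0)); clear -b0 b1; nra.
rewrite bE expRD.
have e0 := expR_ge0 (u + w / 2).
have [E EE] : exists E, expR (u + w / 2) = E by eexists.
rewrite EE in e0 e1 hs' *.
apply: (@le_trans _ _ (E * (1 - b * (999 / 1000)))).
  exact: ler_wpM2l.
have ch0 : 0 <= (1 + c) * h by apply: mulr_ge0 => //; clear -c0; lra.
have b2 : 488 / 1000 * ((1 + c) * h) <= b.
  have x1 : 4888 / 10000 * (1 + c) * k <= m * k by exact: ler_wpM2r.
  have x2 : (1 + c) * (999 / 1000 * h) <= (1 + c) * k by apply: ler_wpM2l => //; clear -c0; lra.
  rewrite bE in x1; clear -x1 x2 ch0; lra.
have : 971 / 1000 * b <= E * b by exact: ler_wpM2r.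
clear -ch0 b2 hs'; lra.
Qed.

(** * The potential along one round *)
Lemma is_derive_phiNH (R : realType) (y t : R) : 0 < t ->
  is_derive y 1 (fun z => phiNH z t) (y / t * phiNH y t).
Proof.
move=> t0; rewrite /phiNH.
apply: is_derive_eq.
rewrite /GRing.scale /=.
have tn : t != 0 by rewrite gt_eqF.
have sn : Num.sqrt t != 0 by rewrite gt_eqF ?sqrtr_gt0.
by field; rewrite sn tn.
Qed.

Lemma dx_phiNH (R : realType) (y t : R) : 0 < t ->
  dx_phi (@phiNH R) y t = y / t * phiNH y t.
Proof.
by move=> t0; rewrite /dx_phi derive1E; case: (is_derive_phiNH _ y t t0).
Qed.

Lemma dxx_phiNH (R : realType) (y t : R) : 0 < t ->
  dxx_phi (@phiNH R) y t = (1 + y ^+ 2 / t) / t * phiNH y t.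
Proof.
move=> t0; rewrite /dxx_phi.
have -> : (fun z => derive1 (fun w => phiNH w t) z) = (fun z => z / t * phiNH z t).
  by apply/funext => z; exact: dx_phiNH.
have h : is_derive y 1 (fun z => z / t * phiNH z t) ((1 + y ^+ 2 / t) / t * phiNH y t).
  rewrite /phiNH; apply: is_derive_eq.
  rewrite /GRing.scale /=.
  have tn : t != 0 by rewrite gt_eqF.
  have sn : Num.sqrt t != 0 by rewrite gt_eqF ?sqrtr_gt0.
  by field; rewrite sn tn.
by rewrite derive1E; case: h.
Qed.

Lemma sqrt_inv_le_expR (R : realType) (h : R) : 0 <= h ->
  (Num.sqrt (1 + h))^-1 <= expR (- (1 / 2) * (h / (1 + h))).
Proof.
move=> h0; have p : 0 < 1 + h by lra.
have pn : 1 + h != 0 by rewrite gt_eqF.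
rewrite mulNr expRN lef_pV2 ?posrE ?expR_gt0 ?sqrtr_gt0//.
rewrite -(@ler_pXn2r _ 2) ?nnegrE ?expR_ge0 ?sqrtr_ge0// sqr_sqrtr ?(ltW p)//.
rewrite -expRM_natl.
have -> : 2 * (1 / 2 * (h / (1 + h))) = h / (1 + h) by rewrite mulrA mulrC; field; rewrite ?pn.
have := expR_ge1Dx (- (h / (1 + h))).
have -> : 1 + - (h / (1 + h)) = (1 + h)^-1 by field; rewrite ?pn.
by rewrite expRN lef_pV2 ?posrE ?expR_gt0.
Qed.

Lemma phiNH_gt0 (R : realType) (y t : R) : 0 < t -> 0 < phiNH y t.
Proof. by move=> t0; rewrite /phiNH mulr_gt0 ?expR_gt0// invr_gt0 sqrtr_gt0. Qed.

Lemma phiNH_le_abs (R : realType) (y z t : R) : 0 < t -> 0 <= y <= `|z| ->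
  phiNH y t <= phiNH z t.
Proof.
move=> t0 /andP[y0 yz]; rewrite /phiNH ler_wpM2l ?invr_ge0 ?sqrtr_ge0//.
rewrite ler_expR ler_wpM2r ?invr_ge0 ?mulr_ge0 ?(ltW t0)//.
by rewrite -(real_normK (num_real z)) ler_pXn2r ?nnegrE.
Qed.

Lemma phiNH_decr (R : realType) (y t t' : R) : 0 < t -> t < t' ->
  phiNH y t' < phiNH y t.
Proof.
move=> t0 tt'; have t'0 := lt_trans t0 tt'.
rewrite /phiNH; apply: (@lt_le_trans _ _ ((Num.sqrt t)^-1 * expR (y ^+ 2 / (2 * t')))).
  by rewrite ltr_pM2r ?expR_gt0// ltf_pV2 ?posrE ?sqrtr_gt0// ltr_sqrt.
rewrite ler_wpM2l ?invr_ge0 ?sqrtr_ge0// ler_expR ler_wpM2l ?sqr_ge0//.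
by rewrite lef_pV2 ?posrE ?mulr_gt0// ler_pM2l ?(ltW tt').
Qed.

(** [X'] is the projected new position; the bound by [|X + D|] is enough because [phiNH] grows with
    the modulus. *)
Lemma phiNH_step (R : realType) (X X' D t d : R) : 0 < t -> 0 <= X' <= `|X + D| ->
  0 <= d ->
  D ^+ 2 / t <= 1 / 2000 -> X ^+ 2 / t * (D ^+ 2 / t) <= 1 / 1200 ->
  d / t <= 1 / 2000 -> X ^+ 2 / t * (d / t) <= 1 / 1200 ->
  phiNH X' (t + 11 / 10 * d) <=
  phiNH X t * (1 + X * D / t + (1 + X ^+ 2 / t) / 2 *
     ((103 / 100 * D ^+ 2 - 94 / 100 * (11 / 10 * d)) / t)).
Proof.
move=> t0 X'D d0 w1 cw dt1 cd.
have tn : t != 0 by rewrite gt_eqF.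
have c0 : 0 <= X ^+ 2 / t by rewrite divr_ge0 ?sqr_ge0 ?(ltW t0).
have w0 : 0 <= D ^+ 2 / t by rewrite divr_ge0 ?sqr_ge0 ?(ltW t0).
have h0 : 0 <= d / t by rewrite divr_ge0// ltW.
have [c cE] : exists c, X ^+ 2 / t = c by eexists.
have [u u_E] : exists u, X * D / t = u by eexists.
have [w wE] : exists w, D ^+ 2 / t = w by eexists.
have [h hE] : exists h, 11 / 10 * (d / t) = h by eexists.
have zE k : k != 0 -> (X + D) ^+ 2 / (2 * (t * k)) = (c / 2 + u + w / 2) / k.
  by move=> k0; rewrite -cE -u_E -wE; field; rewrite ?tn ?k0.
have uE : u ^+ 2 = c * w by rewrite -u_E -cE -wE; field.
have th : t + 11 / 10 * d = t * (1 + h) by rewrite -hE; field.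
have z0 : X ^+ 2 / (2 * t) = c / 2 by rewrite -cE; field.
have rE : (103 / 100 * D ^+ 2 - 94 / 100 * (11 / 10 * d)) / t =
    103 / 100 * w - 94 / 100 * h by rewrite -wE -hE; field.
rewrite cE in c0 cw cd; rewrite wE in w0 cw w1.
have ch : c * h <= 1 / 1000 by rewrite -hE mulrCA; clear -cd; lra.
have h1 : 0 <= h <= 1 / 1800 by rewrite -hE; clear -h0 dt1; lra.
have hw : 0 <= w <= 1 / 2000 by rewrite w0.
have hp : 0 < 1 + h by case/andP: h1 => h1 _; clear -h1; lra.
have hn : 1 + h != 0 by rewrite gt_eqF.
rewrite th u_E cE rE.
apply: (le_trans (phiNH_le_abs _ _ _ _ (mulr_gt0 t0 hp) X'D)).
rewrite /phiNH zE// z0 sqrtrM ?(ltW t0)// invfM.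
have s0 : 0 <= (Num.sqrt t)^-1 by rewrite invr_ge0 sqrtr_ge0.
rewrite -[X in X <= _]mulrA -[X in _ <= X]mulrA; apply: ler_wpM2l => //.
apply: (@le_trans _ _ (expR (- (1 / 2) * (h / (1 + h))) *
  expR ((c / 2 + u + w / 2) / (1 + h)))).
  by apply: ler_wpM2r; rewrite ?expR_ge0//; apply: sqrt_inv_le_expR; case/andP: h1.
rewrite -expRD.
have -> : - (1 / 2) * (h / (1 + h)) + (c / 2 + u + w / 2) / (1 + h) =
   c / 2 + (u + w / 2 - (1 / 2 + (c / 2 + u + w / 2)) * (h / (1 + h))).
  by field.
rewrite expRD; apply: ler_wpM2l; first exact: expR_ge0.
exact: (expR_time_le _ _ _ _ _ c0 hw uE cw h1 ch).
Qed.

(** Summation removes the first-order terms, and the last hypothesis, the update rule of [V], turns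
    the weighted sum of [D^2] into [d] times the total weight. What remains has the sign of
    [103/100 - 94/100 * 11/10 = - 4/1000]. *)
Lemma phiNH_sum_step (R : realType) (N : nat) (X X' D : 'I_N -> R) (t d : R) :
  0 < t -> (forall i, 0 <= X' i <= `|X i + D i|) -> 0 <= d ->
  (forall i, D i ^+ 2 / t <= 1 / 2000) ->
  (forall i, X i ^+ 2 / t * (D i ^+ 2 / t) <= 1 / 1200) ->
  d / t <= 1 / 2000 -> (forall i, X i ^+ 2 / t * (d / t) <= 1 / 1200) ->
  \sum_(i < N) phiNH (X i) t * (X i * D i) = 0 ->
  \sum_(i < N) phiNH (X i) t * (1 + X i ^+ 2 / t) * D i ^+ 2 =
    d * \sum_(i < N) phiNH (X i) t * (1 + X i ^+ 2 / t) ->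
  \sum_(i < N) phiNH (X' i) (t + 11 / 10 * d) <= \sum_(i < N) phiNH (X i) t.
Proof.
move=> t0 hX' d0 hw hcw hd hcd S1 S2.
have tn : t != 0 by rewrite gt_eqF.
apply: le_trans.
  by apply: ler_sum => i _; apply: (phiNH_step _ _ _ (D i) _ _ t0 (hX' i) d0).
pose a i := phiNH (X i) t * (1 + X i ^+ 2 / t).
rewrite (eq_bigr (fun i => phiNH (X i) t + t^-1 * (phiNH (X i) t * (X i * D i)) +
  103 / 200 / t * (a i * D i ^+ 2) - 1034 / 2000 * d / t * a i)); last first.
  by move=> i _; rewrite /a; field.
rewrite sumrB !big_split /= -!mulr_sumr S1 S2 mulr0 addr0.
have A0 : 0 <= d * (\sum_(i < N) a i) / t.
  rewrite divr_ge0 ?(ltW t0)// mulr_ge0// sumr_ge0// => i _.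
  by rewrite mulr_ge0 ?(ltW (phiNH_gt0 _ _ _ t0))// addr_ge0// divr_ge0 ?sqr_ge0// ltW.
rewrite -/a.
have -> : 103 / 200 / t * (d * \sum_(i < N) a i) = 103 / 200 * (d * (\sum_(i < N) a i) / t).
  by ring.
have -> : 1034 / 2000 * d / t * (\sum_(i < N) a i) = 1034 / 2000 * (d * (\sum_(i < N) a i) / t).
  by ring.
lra.
Qed.

(** * The sharp estimate for two experts *)
(* Since e1 u1 = - e2 u2, a bound on the product |u1 u2| bounds each factor; AM-GM gives
   it with a smaller constant than bounding |u1| and |u2| separately, and the slack in
   [pair_time_step] requires this. *)
Lemma pair_ratio_le (R : realType) (s d e1 e2 c1 c2 u1 u2 w1 w2 : R) :
  1 <= s <= 113 / 100 -> 0 <= d <= 1 / 2000 ->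
  1 <= e1 -> 1 <= e2 -> e1 + e2 = 2 * s ->
  0 <= c1 <= 2 * (e1 - 1) -> 0 <= c2 <= 2 * (e2 - 1) ->
  0 <= w1 -> 0 <= w2 -> u1 ^+ 2 = c1 * w1 -> u2 ^+ 2 = c2 * w2 ->
  e1 * u1 + e2 * u2 = 0 -> w1 + w2 <= 2 * d * (2 * s - 1) ->
  `|u1| <= s - 1 + 53 / 100 * d.
Proof.
move=> /andP[s1 s2] /andP[d0 d1] e11 e21 es /andP[c10 c11] /andP[c20 c21].
move=> w10 w20 u1E u2E ue wd.
have [eta etaE] : exists eta, s - 1 = eta by eexists.
have seta : s = 1 + eta by rewrite -etaE addrCA subrr addr0.
rewrite seta {s etaE seta} in s1 s2 es wd *.
have eta0 : 0 <= eta by clear -s1; lra.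
have uu : `|u1| * `|u2| <= eta * (w1 + w2).
  rewrite -(@ler_pXn2r _ 2) ?nnegrE ?mulr_ge0 ?addr_ge0//.
  rewrite exprMn -!normrX u1E u2E !ger0_norm ?mulr_ge0//.
  have cc : c1 * c2 <= (2 * eta) ^+ 2.
    have := sqr_ge0 (c1 - c2).
    have : (c1 + c2) ^+ 2 <= (4 * eta) ^+ 2.
      by rewrite ler_pXn2r ?nnegrE //; clear -c10 c20 c11 c21 es eta0; lra.
    clear; nra.
  have ww : w1 * w2 <= (w1 + w2) ^+ 2 / 4.
    by have := sqr_ge0 (w1 - w2); clear; nra.
  have -> : c1 * w1 * (c2 * w2) = (c1 * c2) * (w1 * w2) by ring.
  apply: (le_trans (ler_pM _ _ cc ww)); rewrite ?mulr_ge0//.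
  by rewrite le_eqVlt; apply/orP; left; apply/eqP; field.
have eu : e1 * `|u1| = e2 * `|u2|.
  have : e1 * u1 = - (e2 * u2) by clear -ue; lra.
  move=> /(congr1 Num.norm); rewrite normrN !normrM (ger0_norm (_ : 0 <= e1))//.
    by rewrite (ger0_norm (_ : 0 <= e2))//; clear -e21; lra.
  clear -e11; lra.
have v10 : 0 <= `|u1| by []. have v20 : 0 <= `|u2| by [].
move: (`|u1|) (`|u2|) uu eu v10 v20 => v1 v2 uu eu v10 v20.
clear u1E u2E ue c10 c11 c20 c21.
have vsq : v1 ^+ 2 <= 2 * (1 + 2 * eta) ^+ 2 * (eta * d).
  have h1 : v1 ^+ 2 <= e1 * v1 ^+ 2.
    by rewrite -[X in X <= _]mul1r ler_wpM2r ?sqr_ge0.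
  have h2 : e1 * v1 ^+ 2 = e2 * (v1 * v2) by rewrite expr2 mulrA eu; ring.
  have h3 : e2 * (v1 * v2) <= (1 + 2 * eta) * (eta * (w1 + w2)).
    by apply: ler_pM => //; rewrite ?mulr_ge0//; clear -es e11 e21; lra.
  have h4 : (1 + 2 * eta) * (eta * (w1 + w2)) <=
      (1 + 2 * eta) * (eta * (2 * d * (2 * (1 + eta) - 1))).
    by do 2 (apply: ler_wpM2l; first by clear -eta0; lra).
  rewrite h2 in h1; apply: (le_trans h1); apply: (le_trans h3); apply: (le_trans h4).
  by rewrite le_eqVlt; apply/orP; left; apply/eqP; ring.
have -> : 1 + eta - 1 = eta by ring.
rewrite -(@ler_pXn2r _ 2) ?nnegrE//; last by clear -eta0 d0; lra.
apply: (le_trans vsq).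
have ed0 : 0 <= eta * d by exact: mulr_ge0.
(* For small [eta], [(1 + 2 eta)^2 <= 1.06] and [2 * 1.06 eta d = 4 * 0.53 eta d <= (eta + 0.53
   d)^2], which is the origin of 53/100. For larger [eta], [d <= eta / 20] makes the product small
   against [eta^2]. *)
have [etas|etal] := leP eta (1 / 100).
  have q : (1 + 2 * eta) ^+ 2 <= 106 / 100 by clear -eta0 etas; nra.
  have : (1 + 2 * eta) ^+ 2 * (eta * d) <= 106 / 100 * (eta * d) by exact: ler_wpM2r.
  by have := sqr_ge0 (eta - 53 / 100 * d); clear; nra.
have q : (1 + 2 * eta) ^+ 2 <= 2 by clear -eta0 s2; nra.
have : (1 + 2 * eta) ^+ 2 * (eta * d) <= 2 * (eta * d) by exact: ler_wpM2r.
have : eta * d <= eta * (eta / 20) by apply: ler_wpM2l => //; clear -etal d1; lra.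
have := sqr_ge0 eta; have := sqr_ge0 d; clear -ed0; nra.
Qed.

Lemma pair_sum_step (R : realType) (s d e1 e2 c1 c2 u1 u2 w1 w2 : R) :
  1 <= s <= 113 / 100 -> 0 <= d <= 1 / 2000 ->
  1 <= e1 -> 1 <= e2 -> e1 + e2 = 2 * s ->
  0 <= c1 <= 2 * (e1 - 1) -> 0 <= c2 <= 2 * (e2 - 1) ->
  e1 * c1 <= e1 ^+ 2 - 1 -> e2 * c2 <= e2 ^+ 2 - 1 ->
  0 <= w1 -> 0 <= w2 -> u1 ^+ 2 = c1 * w1 -> u2 ^+ 2 = c2 * w2 ->
  e1 * u1 + e2 * u2 = 0 ->
  s ^+ 2 * (e1 * (1 + c1) * w1 + e2 * (1 + c2) * w2) =
     d * (e1 * (1 + c1) + e2 * (1 + c2)) ->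
  s ^+ 2 * (e1 * (1 + u1 + w1 / 2 * (1 + c1) * (1 + (51 / 50 * `|u1| + 13 / 50 * w1))) +
   e2 * (1 + u2 + w2 / 2 * (1 + c2) * (1 + (51 / 50 * `|u2| + 13 / 50 * w2)))) <=
  2 * s ^+ 3 + d * s * (2 * s - 1) * (1 + (1021 / 1000 * (s - 1) + 1061 / 1000 * d)).
Proof.
move=> hs hd e11 e21 es hc1 hc2 ec1 ec2 w10 w20 u1E u2E ue S2.
have := hs => /andP[s1 s2]; have := hd => /andP[d0 d1].
have := hc1 => /andP[c10 _]; have := hc2 => /andP[c20 _].
(* [e (1 + c)] is at most [e + e^2 - 1], which is convex in [e]; with [e1 + e2 = 2 s] its sum is
   largest at the pair [(1, 2 s - 1)]. *)
have A1 : e1 * (1 + c1) + e2 * (1 + c2) <= 2 * (s * (2 * s - 1)).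
  have : 0 <= (e1 - 1) * (e2 - 1) by apply: mulr_ge0; [clear -e11|clear -e21]; lra.
  have := congr1 (fun x => x ^+ 2) es; clear -ec1 ec2 es; nra.
have w1e : w1 <= e1 * (1 + c1) * w1.
  by rewrite -[X in X <= _]mul1r ler_wpM2r//; clear -e11 c10; nra.
have w2e : w2 <= e2 * (1 + c2) * w2.
  by rewrite -[X in X <= _]mul1r ler_wpM2r//; clear -e21 c20; nra.
have A2 : d * (e1 * (1 + c1) + e2 * (1 + c2)) <= d * (2 * (s * (2 * s - 1))).
  exact: ler_wpM2l.
have s0 : 0 < s by clear -s1; lra.
have ww : s * (w1 + w2) <= 2 * d * (2 * s - 1).
  rewrite -(ler_pM2l s0) mulrA -expr2.
  apply: (@le_trans _ _ (s ^+ 2 * (e1 * (1 + c1) * w1 + e2 * (1 + c2) * w2))).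
    by apply: ler_wpM2l; [exact: sqr_ge0|exact: lerD].
  by rewrite S2; apply: (le_trans A2); clear; lra.
have ww0 : 0 <= w1 + w2 by exact: addr_ge0.
have wd : w1 + w2 <= 2 * d * (2 * s - 1).
  by apply: le_trans ww; rewrite -[X in X <= _]mul1r; apply: ler_wpM2r.
have wd' : w1 + w2 <= 2 * d + 1 / 1000 * (s - 1).
  rewrite -(ler_pM2l s0); apply: (le_trans ww).
  have : 0 <= (1 / 2000 - d) * (s - 1) by apply: mulr_ge0; [clear -d1|clear -s1]; lra.
  have : 0 <= (s - 1) ^+ 2 by exact: sqr_ge0.
  clear -s1 d0; nra.
have U1 := pair_ratio_le _ _ _ _ _ _ _ _ _ _ _ hs hd e11 e21 es hc1 hc2 w10 w20 u1E u2E ue wd.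
have U2 : `|u2| <= s - 1 + 53 / 100 * d.
  by apply: (pair_ratio_le _ _ _ e2 e1 c2 c1 u2 u1 w2 w1); rewrite // addrC.
(* This is [51/50 |u| + 13/50 w] with [|u| <= s - 1 + 53/100 d] and [w <= 2 d + (s - 1) / 1000],
   rounded up. *)
pose eb := 1021 / 1000 * (s - 1) + 1061 / 1000 * d.
have b1 : 51 / 50 * `|u1| + 13 / 50 * w1 <= eb.
  by rewrite /eb; clear -U1 wd' w20 s1 d0; lra.
have b2 : 51 / 50 * `|u2| + 13 / 50 * w2 <= eb.
  by rewrite /eb; clear -U2 wd' w10 s1 d0; lra.
have g1 : e1 * (w1 / 2 * (1 + c1) * (1 + (51 / 50 * `|u1| + 13 / 50 * w1))) <=
   (e1 * (1 + c1) * w1) / 2 * (1 + eb).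
  have -> : e1 * (w1 / 2 * (1 + c1) * (1 + (51 / 50 * `|u1| + 13 / 50 * w1))) =
    (e1 * (1 + c1) * w1) / 2 * (1 + (51 / 50 * `|u1| + 13 / 50 * w1)) by field.
  apply: ler_wpM2l; last by rewrite lerD2l.
  by clear -w1e w10; lra.
have g2 : e2 * (w2 / 2 * (1 + c2) * (1 + (51 / 50 * `|u2| + 13 / 50 * w2))) <=
   (e2 * (1 + c2) * w2) / 2 * (1 + eb).
  have -> : e2 * (w2 / 2 * (1 + c2) * (1 + (51 / 50 * `|u2| + 13 / 50 * w2))) =
    (e2 * (1 + c2) * w2) / 2 * (1 + (51 / 50 * `|u2| + 13 / 50 * w2)) by field.
  apply: ler_wpM2l; last by rewrite lerD2l.
  by clear -w2e w20; lra.
apply: (@le_trans _ _ (s ^+ 2 * (2 * s +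
  (e1 * (1 + c1) * w1 + e2 * (1 + c2) * w2) / 2 * (1 + eb)))).
  by apply: ler_wpM2l; [exact: sqr_ge0 | clear -g1 g2 es ue; lra].
have -> X : s ^+ 2 * (2 * s + X / 2 * (1 + eb)) = 2 * s ^+ 3 + (s ^+ 2 * X) * ((1 + eb) / 2).
  by field.
rewrite S2.
have eb0 : 0 <= (1 + eb) / 2 by rewrite /eb; clear -s1 d0; lra.
have := ler_wpM2r eb0 A2; rewrite -/eb.
clear; lra.
Qed.

(* [V] and [d] are V_j and its increment in units of t0. The right-hand side comes from
   the convexity bound exp (r z) <= 1 + r (exp z - 1), which turns the conservation law
   into a comparison of values of s^3 - s^2. *)
Lemma pair_time_step (R : realType) (s s' d V : R) :
  1 <= s <= 1 + V / 2 + V ^+ 2 / 16 -> 0 <= V <= 1 / 4 -> 0 <= d <= 1 / 2000 ->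
  s' = s + d / 2 + (2 * V * d + d ^+ 2) / 16 ->
  2 * s ^+ 3 + d * s * (2 * s - 1) * (1 + (1021 / 1000 * (s - 1) + 1061 / 1000 * d))
  <= 2 * s ^+ 2 + 2 * s' ^+ 2 * (s' - 1).
Proof.
move=> /andP[s1 s2] /andP[V0 V1] /andP[d0 d1] ->.
(* [V <= 1/4] gives [s - 1 <= 33/64 V], and [48/100 < 16/33]. *)
have Vs : 48 / 100 * (s - 1) <= V / 4.
  have : V ^+ 2 <= V * (1 / 4) by rewrite expr2; apply: ler_wpM2l.
  clear -s2 V0; lra.
have sb : s <= 113 / 100.
  have : V ^+ 2 <= V * (1 / 4) by rewrite expr2; apply: ler_wpM2l.
  clear -s2 V0 V1; lra.
clear s2 V1.
have [eta etaE] : exists eta, s - 1 = eta by eexists.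
have seta : s = 1 + eta by rewrite -etaE addrCA subrr addr0.
rewrite etaE seta {s etaE seta} in s1 sb Vs *.
have eta0 : 0 <= eta by clear -s1; lra.
have eta1 : eta <= 13 / 100 by clear -sb; lra.
have [k kE] : exists k, 1 + V / 4 + d / 8 = k by eexists.
have -> : 1 + eta + d / 2 + (2 * V * d + d ^+ 2) / 16 = 1 + eta + d / 2 * k.
  by rewrite -kE; field.
have Vs' : 48 / 100 * eta <= V / 4 by clear -Vs; lra.
have k1 : 1 + 48 / 100 * eta + d / 8 <= k by clear -kE Vs'; lra.
clear V Vs V0 kE Vs' s1 sb.
(* First-order comparison in [d]: [(1 + eta) (1 + 3 eta)] is half the derivative of [2 s^3 - 2 s^2].
   The extra [d] is paid for by the second-order term of that expansion, in [key4]. *)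
have key : (1 + 2 * eta) * (1 + (1021 / 1000 * eta + 1061 / 1000 * d)) <=
    (1 + 48 / 100 * eta + d / 8) * (1 + 3 * eta) + d.
  have : eta * d <= eta * (1 / 2000) by exact: ler_wpM2l.
  have : eta * eta <= eta * (13 / 100) by exact: ler_wpM2l.
  have : 0 <= eta * d by exact: mulr_ge0.
  clear -eta0 d0; nra.
have key2 : (1 + 48 / 100 * eta + d / 8) * (1 + 3 * eta) <= k * (1 + 3 * eta).
  by apply: ler_wpM2r => //; clear -eta0; lra.
have key3 : (1 + eta) * ((1 + 2 * eta) * (1 + (1021 / 1000 * eta + 1061 / 1000 * d))) <=
   (1 + eta) * (k * (1 + 3 * eta) + d).
  by apply: ler_wpM2l; [clear -eta0|clear -key key2]; lra.
have k1' : 1 <= k by clear -k1 eta0 d0; lra.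
have k2 : 1 <= k ^+ 2 by clear -k1'; nra.
have key4 : (1 + eta) * d <= d / 2 * (2 + 3 * eta) * k ^+ 2.
  rewrite -[X in X <= _]mulr1; apply: ler_pM => //.
  - by apply: mulr_ge0 => //; clear -eta0; lra.
  - have : 0 <= eta * d by exact: mulr_ge0. clear; lra.
have k3 : 0 <= d ^+ 3 * k ^+ 3 by apply: mulr_ge0; apply: exprn_ge0 => //; clear -k1'; lra.
have := ler_wpM2l d0 key3; have := ler_wpM2l d0 key4.
clear -k3; lra.
Qed.

(** * From time bounds to the regret bound *)
(* Bernoulli's inequality T ^ (T / s^2) >= 1 + (T / s^2) (T - 1) reduces the claim to
   a polynomial one. *)
Lemma log_target (R : realType) (s T m Y : R) :
  1 <= s -> s ^+ 2 <= T -> 1 <= m -> 0 < Y -> s ^+ 2 * (Y ^+ 2 - 1) <= T * (T - 1) ->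
  s ^+ 2 * ln (m * Y) <= T * ln m + T / 2 * ln T.
Proof.
move=> s1 sT m1 Y0 h.
have m0 : 0 < m by clear -m1; lra.
have s20 : 1 <= s ^+ 2 by clear -s1; nra.
have sp : 0 < s ^+ 2 by clear -s20; lra.
have T1 : 1 <= T by exact: le_trans sT.
rewrite lnM ?posrE// mulrDr; apply: lerD.
  by apply: ler_wpM2r => //; exact: ln_ge0.
pose r := T / s ^+ 2.
have r1 : 1 <= r by rewrite /r ler_pdivlMr// mul1r.
have T10 : 0 <= T - 1 by rewrite subr_ge0.
have b := bernoulli_ln _ _ _ r1 T10; rewrite addrCA subrr addr0 in b.
have Yr : Y ^+ 2 <= 1 + r * (T - 1).
  have rE : s ^+ 2 * (r * (T - 1)) = T * (T - 1).
    by rewrite /r; field; rewrite gt_eqF//; clear -s1; lra.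
  by rewrite -(ler_pM2l sp) mulrDr rE; clear -h; lra.
have Y20 : 0 < Y ^+ 2 by exact: exprn_gt0.
have : ln (Y ^+ 2) <= r * ln T.
  apply: le_trans b; rewrite ler_ln ?posrE//.
  by apply: lt_le_trans Yr.
rewrite lnXn// -mulr_natl => /(ler_wpM2l (ltW sp)).
have -> : s ^+ 2 * (r * ln T) = T * ln T.
  by rewrite /r; field; rewrite gt_eqF//; clear -s1; lra.
clear; lra.
Qed.

(** [(2 s)^2 = (8/5 s^2) (5/2)] is at most [T * sqrt T], since [T >= 32/5 >= (5/2)^2]; moreover
    [3/2 s^2 <= T]. The factor 8/5 is what [T >= 1 + 20/11 (s^2 - 1)] provides for [s >= 2]. *)
Lemma log_target_large (R : realType) (s T m : R) :
  2 <= s -> 8 / 5 * s ^+ 2 <= T -> 1 <= m ->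
  s ^+ 2 * ln (m * (2 * s)) <= T * ln m + T / 2 * ln T.
Proof.
move=> s2 sT m1.
have m0 : 0 < m by clear -m1; lra.
have s4 : 4 <= s ^+ 2 by clear -s2; nra.
have T1 : 32 / 5 <= T by clear -s4 sT; lra.
rewrite lnM ?posrE//; last by clear -s2; lra.
rewrite mulrDr; apply: lerD.
  by apply: ler_wpM2r; [exact: ln_ge0|clear -sT s4; lra].
have L1 : ln (8 / 5 * s ^+ 2) <= ln T.
  by rewrite ler_ln ?posrE//; [clear -s4|clear -T1]; lra.
have L2 : 2 * ln (5 / 2) <= ln T.
  rewrite mulr_natl -lnXn; last by clear; lra.
  by rewrite ler_ln ?posrE ?expr2; [|clear|clear -T1]; lra.
have L3 : 2 * ln (2 * s) = ln (8 / 5 * s ^+ 2) + ln (5 / 2).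
  rewrite mulr_natl -lnXn; last by clear -s2; lra.
  rewrite -lnM ?posrE; [|clear -s4; lra|clear; lra].
  by congr ln; field.
have lT : 0 <= ln T by apply: ln_ge0; clear -T1; lra.
have p1 : s ^+ 2 * (2 * ln (2 * s)) <= s ^+ 2 * (3 / 2 * ln T).
  by apply: ler_wpM2l; [clear -s4|clear -L1 L2 L3]; lra.
have p2 : (3 / 2 * s ^+ 2) * ln T <= T * ln T.
  by apply: ler_wpM2r => //; clear -sT s4; lra.
clear -p1 p2; lra.
Qed.

Lemma log_regret_pair (R : realType) (s V : R) : 1 <= s -> 0 <= V ->
  s ^+ 2 <= 1 + 11 / 10 * V -> (V <= 1 / 4 -> s <= 1 + V / 2 + V ^+ 2 / 16) ->
  s ^+ 2 * ln (2 * s - 1) <= (1 + 2 * V) / 2 * ln (1 + 2 * V).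
Proof.
move=> s1 V0 sV small.
(* The left-hand side increases with [s], so [s] may be replaced by either upper bound on it. *)
suff [z [sz zT]] : exists z, s <= z /\ z ^+ 2 * ln (2 * z - 1) <= (1 + 2 * V) / 2 * ln (1 + 2 * V).
  apply: le_trans zT; apply: ler_pM; rewrite ?sqr_ge0//.
  - by apply: ln_ge0; clear -s1; lra.
  - by rewrite ler_pXn2r ?nnegrE//; clear -s1 sz; lra.
  - by rewrite ler_ln ?posrE; clear -s1 sz; lra.
have [Vs|Vl] := leP V (1 / 4).
  exists (1 + V / 2 + V ^+ 2 / 16); split; first exact: small.
  (* Both sides of the polynomial condition of [log_target] start with [2 V]; their [V^2]
     coefficients are 13/4 and 4, so the term [V^2 / 16] is affordable. *)
  have := log_target _ (1 + V / 2 + V ^+ 2 / 16) (1 + 2 * V) 1 (1 + V + V ^+ 2 / 8).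
  have V20 : 0 <= V ^+ 2 by exact: sqr_ge0.
  have V2 : V ^+ 2 <= V / 4 by rewrite expr2; clear -V0 Vs; nra.
  rewrite ln1 mulr0 add0r mul1r => h.
  have -> : 2 * (1 + V / 2 + V ^+ 2 / 16) - 1 = 1 + V + V ^+ 2 / 8 by field.
  apply: h => //; [clear -V0 V20; lra| |clear -V0 V20; lra|].
    rewrite expr2; clear -V0 V20 V2 Vs; nra.
  have W0 : 0 <= V ^+ 2 / 16 by clear -V20; lra.
  have g2 : (1 + V / 2 + V ^+ 2 / 16) ^+ 2 <= 1 + V + 394 / 1000 * V ^+ 2.
    have : V ^+ 2 * V ^+ 2 <= V ^+ 2 * (V / 4) by exact: ler_wpM2l.
    have : V ^+ 2 * V <= V ^+ 2 * (1 / 4) by exact: ler_wpM2l.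
    clear -V0 V20; nra.
  have y2 : (1 + V + V ^+ 2 / 8) ^+ 2 - 1 <= V * (2 + 33 / 25 * V).
    have : V ^+ 2 * V ^+ 2 <= V ^+ 2 * (V / 4) by exact: ler_wpM2l.
    have : V ^+ 2 * V <= V ^+ 2 * (1 / 4) by exact: ler_wpM2l.
    clear -V0 V20; nra.
  have y0 : 0 <= (1 + V + V ^+ 2 / 8) ^+ 2 - 1 by clear -V0 V20; nra.
  apply: (le_trans (ler_pM _ y0 g2 y2)); first exact: sqr_ge0.
  have -> : (1 + 2 * V) * (1 + 2 * V - 1) = V * (2 + 4 * V) by ring.
  rewrite mulrCA; apply: ler_wpM2l => //.
  have : V ^+ 2 * V <= V ^+ 2 * (1 / 4) by exact: ler_wpM2l.
  clear -V0 V2; nra.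
have z0 : 0 <= 1 + 11 / 10 * V by clear -V0; lra.
exists (Num.sqrt (1 + 11 / 10 * V)).
have zE := sqr_sqrtr z0.
have zp := sqrtr_ge0 (1 + 11 / 10 * V).
have [z zz] : exists z, Num.sqrt (1 + 11 / 10 * V) = z by eexists.
rewrite zz in zE zp *; split.
  by rewrite -(@ler_pXn2r _ 2) ?nnegrE//; [rewrite zE|clear -s1; lra].
have VE : V = 10 / 11 * (z ^+ 2 - 1) by rewrite zE; field.
have zl : 1129 / 1000 <= z by clear -zE zp Vl; nra.
clear s s1 sV small z0 zz zE Vl V0.
have [z2|z2] := leP z 2; last first.
  have := log_target_large _ z (1 + 2 * V) 1 (ltW z2).
  rewrite ln1 mulr0 add0r mul1r => h.
  apply: le_trans (h _ _) => //.
    apply: ler_wpM2l; first exact: sqr_ge0.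
    by rewrite ler_ln ?posrE; clear -z2; lra.
  by rewrite VE; clear -z2; nra.
have := log_target _ z (1 + 2 * V) 1 (2 * z - 1).
rewrite ln1 mulr0 add0r mul1r; apply=> //; rewrite ?VE; try by clear -zl; nra.
(* The polynomial condition divided by [z - 1] and a positive multiple of [z]-free constants. The
   cubic is positive at [z = 1], so the coarse time bound fails for small [V]; 1129/1000 is
   [sqrt 1.275], the value at [V = 1/4], rounded down. *)
have p : 84 * z ^+ 3 - 400 * z ^+ 2 + 180 * z + 180 <= 0.
  have : 0 <= z * (z - 1129 / 1000) * (2 - z).
    by apply: mulr_ge0; [apply: mulr_ge0|]; [clear -zl|clear -zl|clear -z2]; lra.
  have : (1129 / 1000) ^+ 2 <= z ^+ 2.
    by clear -zl; nra.
  clear -zl; lra.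
have z1 : 0 <= z - 1 by clear -zl; lra.
have := ler_wpM2l z1 p.
clear; lra.
Qed.

(* For [N >= 3] rounding [N eps] down costs a factor [(K + 1) / K], which is at most 3/2
   unless [K = 1], and in that case [N / (K + 1) >= 3/2]. *)
Lemma log_regret_many (R : realType) (s V K N : R) : 1 <= s -> 0 <= V ->
  s ^+ 2 <= 1 + 11 / 10 * V -> 1 <= K -> (K < 2 -> K = 1) -> K + 1 <= N -> 3 <= N ->
  s ^+ 2 * ln (1 + N / K * (s - 1)) <=
    (1 + 2 * V) * ln (N / (K + 1)) + (1 + 2 * V) / 2 * ln (1 + 2 * V).
Proof.
move=> s1 V0 sV K1 K12 KN N3.
have TE : 1 + 20 / 11 * (s ^+ 2 - 1) <= 1 + 2 * V by clear -sV; lra.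
have [T TT] : exists T, 1 + 2 * V = T by eexists.
rewrite TT in TE *; clear TT sV V V0.
have k0 : 0 < K by clear -K1; lra.
have k1 : 0 < K + 1 by clear -K1; lra.
have m1 : 1 <= N / (K + 1) by rewrite ler_pdivlMr// mul1r.
have nm : N / K = N / (K + 1) * (1 + K^-1).
  by field; rewrite !gt_eqF.
rewrite nm.
have Kv0 : 0 <= K^-1 by rewrite invr_ge0 ltW.
have Kv1 : K^-1 <= 1 by rewrite invf_le1.
have m32 : K < 2 -> 3 / 2 <= N / (K + 1) /\ K^-1 = 1.
  by move=> /K12 ->; rewrite invr1 ler_pdivlMr; [split=> //; clear -N3|clear]; lra.
have Kv2 : 2 <= K -> K^-1 <= 1 / 2.
  by move=> K2; rewrite div1r lef_pV2 ?posrE.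
clear K12 KN N3 nm.
have [m mE] : exists m, N / (K + 1) = m by eexists.
rewrite mE in m1 m32 *; clear mE.
have [v vE] : exists v, K^-1 = v by eexists.
rewrite vE in Kv0 Kv1 m32 Kv2 *; clear vE k0 k1 K1.
have s20 : 1 <= s ^+ 2 by clear -s1; nra.
have sT : s ^+ 2 <= T by clear -TE s20; lra.
have [e eE] : exists e, s - 1 = e by eexists.
have seE : s = 1 + e by rewrite -eE addrCA subrr addr0.
have e0 : 0 <= e by clear -eE s1; lra.
have me0 : 0 <= m * e by apply: mulr_ge0 => //; clear -m1; lra.
have vme : m * (1 + v) * e = m * e + v * (m * e) by ring.
have vme0 : 0 <= v * (m * e) by exact: mulr_ge0.
rewrite eE.
have mono Y : 1 + m * (1 + v) * e <= m * Y -> s ^+ 2 * ln (m * Y) <= T * ln m + T / 2 * ln T ->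
    s ^+ 2 * ln (1 + m * (1 + v) * e) <= T * ln m + T / 2 * ln T.
  move=> h; apply: le_trans; apply: ler_wpM2l; first exact: sqr_ge0.
  have p0 : 0 < 1 + m * (1 + v) * e by rewrite vme; clear -vme0 me0; lra.
  by rewrite ler_ln ?posrE//; apply: lt_le_trans h.
have [s2|s2] := leP 2 s.
  apply: (mono (2 * s)); last first.
    by apply: log_target_large => //; clear -s2 TE; nra.
  rewrite vme seE.
  have : v * (m * e) <= 1 * (m * e) by exact: ler_wpM2r.
  clear -m1; lra.
have T0 : (1 + 20 / 11 * (s ^+ 2 - 1)) * (20 / 11 * (s ^+ 2 - 1)) <= T * (T - 1).
  by apply: ler_pM; clear -TE s20; lra.
have e1 : e <= 1 by clear -s2 eE; lra.
have e20 : 0 <= e ^+ 2 by exact: exprn_ge0.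
have e30 : 0 <= e ^+ 3 by exact: exprn_ge0.
have e43 : e ^+ 4 <= e ^+ 3 by rewrite exprSr -[X in _ <= X]mulr1; apply: ler_wpM2l.
have [K2|K2] := leP 2 K.
  (* From [1 <= m] and [v <= 1/2]: [Y = 1 + 3/2 (s - 1)]. *)
  apply: (mono (3 / 2 * s - 1 / 2)).
    rewrite vme seE.
    have : v * (m * e) <= 1 / 2 * (m * e) by apply: ler_wpM2r => //; exact: Kv2.
    clear -m1; lra.
  apply: log_target => //; first by clear -s1; lra.
  apply: le_trans T0; rewrite seE.
  clear -e0 e20 e30 e43; nra.
have [m3 v1] := m32 K2.
(* Now [1 <= 2/3 m], so [Y = 2/3 + 2 (s - 1)]. Starting at 2/3 instead of 1 compensates for the
   slope 2, too steep for the coarse time bound near [s = 1]. *)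
apply: (mono (2 * s - 4 / 3)).
  by rewrite vme seE v1; clear -m3; lra.
apply: log_target => //; first by clear -s1; lra.
apply: le_trans T0; rewrite seE.
clear -e0 e20 e30 e43; nra.
Qed.

(** * Order statistics *)
(** The first [k.-1.+1] entries of the decreasing sort all reach entry [k.-1], and ties may add
    more. By the convention for rank 0, [k.-1.+1] is [max k 1]. *)
Lemma kth_largest_count (R : realType) (N k : nat) (v : 'I_N -> R) : (k.-1 < N)%N ->
  (k.-1 < #|[pred i | (kth_largest k v <= v i)%R]|)%N.
Proof.
move=> kN.
set ge := fun a b : R => b <= a.
pose s := [seq v i | i <- enum 'I_N].
have ss : size (sort ge s) = N by rewrite size_sort size_map size_enum_ord.
have ge_total : total ge by move=> a b; rewrite /ge le_total.
have ge_trans : transitive ge by move=> a b c ba cb; exact: le_trans cb ba.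
have ge_refl : reflexive ge by move=> a; exact: lexx.
pose P := fun y : R => kth_largest k v <= y.
have cnt : (k.-1 < count P s)%N.
  rewrite -(permP (permEl (perm_sort ge s)) P).
  rewrite -(cat_take_drop k.-1.+1 (sort ge s)) count_cat.
  apply: leq_trans (leq_addr _ _).
  have st : size (take k.-1.+1 (sort ge s)) = k.-1.+1 by rewrite size_takel// ss.
  suff /eqP -> : count P (take k.-1.+1 (sort ge s)) ==
      size (take k.-1.+1 (sort ge s)) by rewrite st.
  rewrite -all_count; apply/(all_nthP 0) => i; rewrite st => ik.
  rewrite nth_take// /P /kth_largest -/ge -/s.
  apply: (sorted_leq_nth ge_trans ge_refl 0 (sort_sorted ge_total s)).
  - by rewrite inE ss; exact: leq_ltn_trans kN.
  - by rewrite inE ss.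
  - exact: ik.
apply: (leq_trans cnt); rewrite /s count_map cardE -size_filter.
rewrite leq_eqVlt; apply/orP; left; apply/eqP; congr size.
by rewrite enumT /enum_mem; apply: eq_filter => i; rewrite /= inE.
Qed.

(** Keeping the floor [a] for the remaining coordinates, rather than dropping them, is what later
    puts [s - 1] instead of [s] into the logarithm. *)
Lemma kth_largest_sum_le (R : realType) (N k : nat) (v g : 'I_N -> R) (a b : R) :
  (k.-1 < N)%N -> a <= b -> (forall i, a <= g i) ->
  (forall i, kth_largest k v <= v i -> b <= g i) ->
  k.-1.+1%:R * (b - a) + N%:R * a <= \sum_(i < N) g i.
Proof.
move=> kN ab ag bg.
have cnt := kth_largest_count _ _ _ v kN.
pose A := [pred i | kth_largest k v <= v i].
apply: (@le_trans _ _ (\sum_(i < N) (a + (b - a) *+ (i \in A)))).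
  rewrite big_split /= sumr_const card_ord -[a *+ N]mulr_natl [X in X <= _]addrC lerD2l.
  have -> : \sum_(i < N) (b - a) *+ (i \in A) = #|A|%:R * (b - a).
    rewrite mulr_natl -sumr_const [RHS]big_mkcond /=.
    by apply: eq_bigr => i _; case: (i \in A).
  by apply: ler_wpM2r; [rewrite subr_ge0|rewrite ler_nat].
apply: ler_sum => i _; case: (boolP (i \in A)) => /=.
  by rewrite inE => /bg; rewrite mulr1n addrCA subrr addr0.
by rewrite mulr0n addr0.
Qed.

(** * Runs of the algorithm *)
(** Here [b = B^2 / t0], [s^2 = t / t0] and [c = X^2 / t]. From [ln N >= 2/3] one gets
    [b <= 3/7168], and by [ln s <= s^2 / 4] the division by [s^2] outweighs the growth of [c] with
    [s]. The total [2/3584 + 3/14336] is below 1/1200. *)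
Lemma step_budget (R : realType) (N s b : R) : 2 <= N -> 1 <= s -> 0 <= b ->
  b * ln N <= 1 / 3584 ->
  b / s ^+ 2 <= 1 / 2000 /\
  (forall c, c <= 2 * ln (N * s) -> c * (b / s ^+ 2) <= 1 / 1200).
Proof.
move=> N2 s1 b0 bN.
have s20 : 1 <= s ^+ 2 by clear -s1; nra.
have sp : 0 < s ^+ 2 by clear -s20; lra.
have lN : 2 / 3 <= ln N.
  by apply: (le_trans (ln2_ge R)); rewrite ler_ln ?posrE//; clear -N2; lra.
have b1 : b <= 3 / 7168.
  have : b * (2 / 3) <= b * ln N by exact: ler_wpM2l.
  clear -bN; lra.
have q0 : 0 <= b / s ^+ 2 by rewrite divr_ge0// ltW.
split.
  by rewrite ler_pdivrMr//; clear -b1 s20; lra.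
move=> c cN.
apply: (le_trans (ler_wpM2r q0 cN)).
rewrite lnM ?posrE; [|clear -N2; lra|clear -s1; lra].
have ls : ln s <= s ^+ 2 / 4.
  have := @le_ln1Dx R (s - 1); rewrite addrCA subrr addr0 => h.
  have : ln s <= s - 1 by apply: h; clear -s1; lra.
  have := sqr_ge0 (s / 2 - 1); clear; nra.
rewrite mulrA ler_pdivrMr//.
have : b * ln s <= 3 / 7168 * (s ^+ 2 / 4).
  by apply: ler_pM => //; apply: ln_ge0.
clear -bN s20; lra.
Qed.

Lemma centered_loss_bound (R : realType) (N : nat) (p l : 'I_N -> R) (B : R) (i : 'I_N) :
  in_simplex p -> (forall i i', `|l i - l i'| <= B) ->
  `|\sum_(k < N) p k * l k - l i| <= B.
Proof.
move=> [p0 p1] lB.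
have -> : \sum_(k < N) p k * l k - l i = \sum_(k < N) p k * (l k - l i).
  under [RHS]eq_bigr do rewrite mulrBr.
  by rewrite sumrB -mulr_suml p1 mul1r.
apply: (le_trans (ler_norm_sum _ _ _)).
rewrite -[B]mul1r -p1 mulr_suml; apply: ler_sum => k _.
by rewrite normrM (ger0_norm (p0 k)) ler_wpM2l.
Qed.

Lemma CP_run_step (R : realType) (N : nat) (B t0 : R) (p l x : nat -> 'I_N -> R)
    (t V : nat -> R) (j : nat) : (0 < N)%N -> 0 < t j ->
  CP_run (@phiNH R) (@proj_nonneg R) B t0 p l x t V ->
  let X := fun i => proj_nonneg (x j i) in
  let D := fun i => x j.+1 i - x j i in
  let d := V j.+1 - V j in
  [/\ (forall i, `|D i| <= B),
      \sum_(i < N) phiNH (X i) (t j) * (X i * D i) = 0,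
      \sum_(i < N) phiNH (X i) (t j) * (1 + X i ^+ 2 / t j) * D i ^+ 2 =
        d * \sum_(i < N) phiNH (X i) (t j) * (1 + X i ^+ 2 / t j),
      (forall i, 0 <= proj_nonneg (x j.+1 i) <= `|X i + D i|) &
      0 <= d <= B ^+ 2].
Proof.
move=> N0 tj [_ _ _ /(_ j)] /=.
pose y i := proj_nonneg (x j i).
pose D0 i := \sum_(k < N) p j.+1 k * l j.+1 k - l j.+1 i.
move=> [[ps pw] lB xE _ VE].
have tn : t j != 0 by rewrite gt_eqF.
have DE i : x j.+1 i - x j i = D0 i by rewrite xE addrAC subrr add0r.
pose a i := phiNH (y i) (t j) * (1 + y i ^+ 2 / t j).
have a0 i : 0 < a i.
  rewrite mulr_gt0 ?phiNH_gt0// ltr_wpDr// divr_ge0 ?sqr_ge0 ?ltW//.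
have DB i : `|D0 i| <= B by exact: centered_loss_bound.
have Sa : 0 < \sum_(i < N) a i.
  rewrite (bigD1 (Ordinal N0)) //=; apply: ltr_pwDl => //.
  by apply: sumr_ge0 => i _; exact: ltW.
have VE' : V j.+1 - V j = (\sum_(i < N) a i * D0 i ^+ 2) / (\sum_(i < N) a i).
  rewrite VE addrAC subrr add0r.
  have w2 i : dxx_phi (@phiNH R) (proj_nonneg (x j i)) (t j) = (t j)^-1 * a i.
    by rewrite dxx_phiNH// /a -/(y i); field.
  under eq_bigr do rewrite w2 -mulrA.
  under [X in _ / X]eq_bigr do rewrite w2.
  rewrite -!mulr_sumr invfM invrK mulrACA mulVf ?mul1r//.
split=> [i|||i|].
- by rewrite DE.
- under eq_bigr do rewrite DE.
  have [/existsP [i wi]|] := boolP [exists i, dx_phi (@phiNH R) (proj_nonneg (x j i)) (t j) != 0].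
    have [|c pc] := pw; first by exists i.
    have cn : c != 0.
      apply/eqP => c0.
      have h0 : \sum_(k < N) p j.+1 k = 0 by apply: big1 => k _; rewrite pc c0 mul0r.
      by have /eqP := proj2 ps; rewrite h0 eq_sym oner_eq0.
    (* The instantaneous regret has mean zero under the play, and the play is proportional to
       [y * phiNH y]. *)
    have : \sum_(k < N) p j.+1 k * D0 k = 0.
      under eq_bigr do rewrite /D0 mulrBr.
      by rewrite sumrB -mulr_suml; case: ps => _ ->; rewrite mul1r subrr.
    move=> pD; have ct : c / t j != 0 by rewrite mulf_neq0 ?invr_eq0.
    apply: (mulfI ct); rewrite mulr0 -[RHS]pD mulr_sumr; apply: eq_bigr => k _.
    by rewrite pc dx_phiNH// -/(y k); field.
  (* All weights vanish and the play is arbitrary, but then each term of the sum vanishes by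
     itself. *)
  move=> /existsPn h; rewrite big1// => k _.
  have := h k; rewrite negbK dx_phiNH// -/(y k) => /eqP yk.
  have -> : phiNH (y k) (t j) * (y k * D0 k) =
    t j * D0 k * (y k / t j * phiNH (y k) (t j)) by field.
  by rewrite yk mulr0.
- under eq_bigr do rewrite DE.
  by rewrite VE' -mulrA mulVf ?mulr1// gt_eqF.
- rewrite /proj_nonneg le_max lexx orbT /= ge_max normr_ge0 andbT.
  apply: le_trans (ler_norm _).
  have : x j i <= Num.max (x j i) 0 by rewrite le_max lexx.
  clear; lra.
- rewrite VE'; apply/andP; split.
    rewrite divr_ge0 ?(ltW Sa)// sumr_ge0// => i _.
    by rewrite mulr_ge0 ?sqr_ge0// ltW.
  rewrite ler_pdivrMr// mulr_sumr; apply: ler_sum => i _.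
  rewrite mulrC ler_wpM2r ?(ltW (a0 i))//.
  rewrite -(real_normK (num_real (D0 i))) ler_pXn2r ?nnegrE//.
  exact: le_trans (DB i).
Qed.

Lemma CP_run_potential (R : realType) (N : nat) (B t0 : R) (p l x : nat -> 'I_N -> R)
    (t V : nat -> R) : 0 < t0 ->
  CP_run (@phiNH R) (@proj_nonneg R) B t0 p l x t V -> forall j,
  t0 <= t j /\
  \sum_(i < N) expR (proj_nonneg (x j i) ^+ 2 / (2 * t j)) = N%:R * Num.sqrt (t j / t0).
Proof.
move=> t00 [x0 tE _ run].
have pot j : t0 <= t j /\
    \sum_(i < N) phiNH (proj_nonneg (x j i)) (t j) = N%:R * (Num.sqrt t0)^-1.
  elim: j => [|j [IHt IHs]].
    rewrite tE lexx; split=> //.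
    under eq_bigr do rewrite x0 /proj_nonneg maxxx /phiNH expr0n /= mul0r expR0 mulr1.
    by rewrite sumr_const card_ord mulr_natl.
  have [_ _ _ [tt ->] _] := run j.
  by split=> //; exact: le_trans tt.
move=> j; have [tj pj] := pot j; split=> //.
have tp : 0 < t j by exact: lt_le_trans tj.
have sn : Num.sqrt (t j) != 0 by rewrite gt_eqF ?sqrtr_gt0.
apply: (mulfI (_ : (Num.sqrt (t j))^-1 != 0)); first by rewrite invr_eq0.
rewrite mulr_sumr; move: pj; rewrite /phiNH => ->.
by rewrite sqrtrM ?(ltW tp)// sqrtrV ?(ltW t00)// mulrCA [_^-1 * _]mulrA mulVf// mul1r.
Qed.

(** The potential at the new position strictly decreases in time and, by [phiNH_sum_step], is at
    most its conserved value at [t + 11/10 d]; so the time that restores this value is no later. The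
    smallness conditions also come from conservation: a single exponential is at most the whole sum
    [N s], whence [X^2 / t <= 2 ln (N s)]. *)
Lemma CP_run_time (R : realType) (N : nat) (B t0 : R) (p l x : nat -> 'I_N -> R)
    (t V : nat -> R) : (1 < N)%N -> 0 < t0 -> 3584 * B ^+ 2 * ln N%:R <= t0 ->
  CP_run (@phiNH R) (@proj_nonneg R) B t0 p l x t V -> forall j,
  [/\ B ^+ 2 / t j <= 1 / 2000,
      (forall i, proj_nonneg (x j i) ^+ 2 / t j * (B ^+ 2 / t j) <= 1 / 1200) &
      0 <= V j /\ t j <= t0 + 11 / 10 * V j].
Proof.
move=> N1 t00 Bt0 run.
have N2 : 2 <= N%:R :> R by rewrite ler_nat.
have budget j : B ^+ 2 / t j <= 1 / 2000 /\
    (forall i, proj_nonneg (x j i) ^+ 2 / t j * (B ^+ 2 / t j) <= 1 / 1200).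
  have [tj pj] := CP_run_potential _ _ _ _ _ _ _ _ _ t00 run j.
  have tp : 0 < t j by exact: lt_le_trans tj.
  have s0 : 0 <= t j / t0 by rewrite divr_ge0 ?ltW.
  have s1 : 1 <= Num.sqrt (t j / t0).
    by rewrite -[X in X <= _]sqrtr1; apply: ler_wsqrtr; rewrite ler_pdivlMr// mul1r.
  have b0 : 0 <= B ^+ 2 / t0 by rewrite divr_ge0 ?sqr_ge0 ?ltW.
  have bN : B ^+ 2 / t0 * ln N%:R <= 1 / 3584.
    by rewrite mulrAC ler_pdivrMr//; clear -Bt0; lra.
  have [h1 h2] := step_budget _ _ _ _ N2 s1 b0 bN.
  have bE : B ^+ 2 / t0 / Num.sqrt (t j / t0) ^+ 2 = B ^+ 2 / t j.
    by rewrite sqr_sqrtr//; field; rewrite !gt_eqF.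
  rewrite bE in h1 h2; split=> // i; apply: h2.
  have e0 : 0 < expR (proj_nonneg (x j i) ^+ 2 / (2 * t j)) by exact: expR_gt0.
  have : expR (proj_nonneg (x j i) ^+ 2 / (2 * t j)) <= N%:R * Num.sqrt (t j / t0).
    by rewrite -pj (bigD1 i) //= lerDl sumr_ge0// => k _; exact: expR_ge0.
  move=> eN; have Ns0 := lt_le_trans e0 eN.
  move: eN; rewrite -ler_ln ?posrE// expRK => h.
  have -> : proj_nonneg (x j i) ^+ 2 / t j = 2 * (proj_nonneg (x j i) ^+ 2 / (2 * t j)).
    by field; rewrite gt_eqF.
  by rewrite ler_pM2l.
move=> j; have [b1 b2] := budget j; split=> //.
elim: {b1 b2} j => [|j [V0 IH]].
  by have [_ -> -> _] := run; rewrite mulr0 addr0.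
have [tj _] := CP_run_potential _ _ _ _ _ _ _ _ _ t00 run j.
have tp : 0 < t j by exact: lt_le_trans tj.
have [b1 b2] := budget j.
have [DB S1 S2 hX /andP[d0 d1]] := CP_run_step _ _ _ _ _ _ _ _ _ j (ltnW N1) tp run.
have d0' : V j <= V j.+1 by rewrite -subr_ge0.
split; first exact: le_trans d0'.
have ti0 : 0 <= (t j)^-1 by rewrite invr_ge0 ltW.
have DB2 i : (x j.+1 i - x j i) ^+ 2 / t j <= B ^+ 2 / t j.
  apply: ler_wpM2r => //; rewrite -(real_normK (num_real (x j.+1 i - x j i))).
  by rewrite ler_pXn2r ?nnegrE//; apply: le_trans (DB i).
have dB : (V j.+1 - V j) / t j <= B ^+ 2 / t j by exact: ler_wpM2r.
have c0 i : 0 <= proj_nonneg (x j i) ^+ 2 / t j by rewrite mulr_ge0 ?sqr_ge0.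
have := phiNH_sum_step _ _ (fun i => proj_nonneg (x j i)) (fun i => proj_nonneg (x j.+1 i))
  (fun i => x j.+1 i - x j i) _ _ tp hX d0
  (fun i => le_trans (DB2 i) b1)
  (fun i => le_trans (ler_wpM2l (c0 i) (DB2 i)) (b2 i))
  (le_trans dB b1)
  (fun i => le_trans (ler_wpM2l (c0 i) dB) (b2 i)) S1 S2.
have [_ _ _ /(_ j) [_ _ _ [tt PE] _]] := run.
rewrite -PE => hle.
suff : t j.+1 <= t j + 11 / 10 * (V j.+1 - V j) by clear -IH; lra.
rewrite leNgt; apply/negP => lt.
have tq : 0 < t j + 11 / 10 * (V j.+1 - V j) by clear -tp d0; lra.
move: hle; rewrite leNgt => /negP; apply.
rewrite (bigD1 (Ordinal (ltnW N1))) //= [ltRHS](bigD1 (Ordinal (ltnW N1))) //=.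
apply: ltr_leD; first exact: phiNH_decr.
by apply: ler_sum => i _; apply: ltW; exact: phiNH_decr.
Qed.

(** The positions move while the time stays at its old value. The time change is left to
    [pair_next], because [expR_time_le] would lose a constant factor. *)
Lemma pair_potential_step (R : realType) (s d t X1 X2 D1 D2 : R) :
  0 < t -> 1 <= s <= 113 / 100 -> 0 <= d <= 1 / 2000 ->
  (D1 ^+ 2 / t <= 1 / 2000) -> (D2 ^+ 2 / t <= 1 / 2000) ->
  X1 ^+ 2 / t * (D1 ^+ 2 / t) <= 1 / 1200 -> X2 ^+ 2 / t * (D2 ^+ 2 / t) <= 1 / 1200 ->
  let e1 := expR (X1 ^+ 2 / (2 * t)) in let e2 := expR (X2 ^+ 2 / (2 * t)) in
  e1 + e2 = 2 * s ->
  e1 * (X1 * D1) + e2 * (X2 * D2) = 0 ->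
  s ^+ 2 * (e1 * (1 + X1 ^+ 2 / t) * D1 ^+ 2 + e2 * (1 + X2 ^+ 2 / t) * D2 ^+ 2) =
    t * (d * (e1 * (1 + X1 ^+ 2 / t) + e2 * (1 + X2 ^+ 2 / t))) ->
  s ^+ 2 * (expR ((X1 + D1) ^+ 2 / (2 * t)) + expR ((X2 + D2) ^+ 2 / (2 * t))) <=
  2 * s ^+ 3 + d * s * (2 * s - 1) * (1 + (1021 / 1000 * (s - 1) + 1061 / 1000 * d)).
Proof.
move=> t0 hs hd w1 w2 cw1 cw2 /=.
have tn : t != 0 by rewrite gt_eqF.
have sq0 (Y : R) : 0 <= Y ^+ 2 / t by rewrite divr_ge0 ?sqr_ge0 ?(ltW t0).
have zE (Y : R) : Y ^+ 2 / (2 * t) = Y ^+ 2 / t / 2 by field.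
have e_ge (Y : R) : 1 + Y ^+ 2 / t / 2 <= expR (Y ^+ 2 / (2 * t)).
  by rewrite zE; exact: expR_ge1Dx.
have e_sinh (Y : R) : expR (Y ^+ 2 / (2 * t)) * (Y ^+ 2 / t) <= expR (Y ^+ 2 / (2 * t)) ^+ 2 - 1.
  have := @ln_le_sinh _ (expR (Y ^+ 2 / (2 * t))).
  rewrite expRK zE => h.
  have : 1 <= expR (Y ^+ 2 / t / 2).
    by rewrite -zE; apply: le_trans (e_ge Y); have := sq0 Y; clear; lra.
  by move=> /h; clear; lra.
have uE (Y D : R) : (Y * D / t) ^+ 2 = Y ^+ 2 / t * (D ^+ 2 / t) by field.
have stepE (Y D : R) : D ^+ 2 / t <= 1 / 2000 -> Y ^+ 2 / t * (D ^+ 2 / t) <= 1 / 1200 ->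
    expR ((Y + D) ^+ 2 / (2 * t)) <= expR (Y ^+ 2 / (2 * t)) *
     (1 + Y * D / t + D ^+ 2 / t / 2 * (1 + Y ^+ 2 / t) *
       (1 + (51 / 50 * `|Y * D / t| + 13 / 50 * (D ^+ 2 / t)))).
  move=> w cw.
  have -> : (Y + D) ^+ 2 / (2 * t) = Y ^+ 2 / (2 * t) + (Y * D / t + D ^+ 2 / t / 2) by field.
  rewrite expRD; apply: ler_wpM2l; first exact: expR_ge0.
  by apply: expR_step_le => //; rewrite sq0.
have E1 := stepE _ _ w1 cw1; have E2 := stepE _ _ w2 cw2.
have g1 := e_ge X1; have g2 := e_ge X2; have q1 := e_sinh X1; have q2 := e_sinh X2.
move: E1 E2 g1 g2 q1 q2; move: (expR (X1 ^+ 2 / (2 * t))) (expR (X2 ^+ 2 / (2 * t))).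
move=> e1 e2 E1 E2 g1 g2 q1 q2 es S1 S2.
apply: (@le_trans _ _ (s ^+ 2 * (_ + _))).
  by apply: ler_wpM2l; [exact: sqr_ge0|exact: (lerD E1 E2)].
have c1 := sq0 X1; have c2 := sq0 X2.
apply: pair_sum_step => //.
- by clear -g1 c1; lra.
- by clear -g2 c2; lra.
- by rewrite c1; clear -g1; lra.
- by rewrite c2; clear -g2; lra.
- apply: (mulfI tn); rewrite mulr0 -[RHS]S1; by field.
- apply: (mulfI tn); rewrite -[RHS]S2; by field.
Qed.

(* [s1] is the new value of sqrt (t / t0), [r] the ratio of the old time to the new one. *)
Lemma pair_next (R : realType) (s s1 s' r z1 z2 : R) :
  1 <= s -> s <= s' -> 0 < s1 -> 0 <= r <= 1 -> r * s1 ^+ 2 = s ^+ 2 ->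
  expR (r * z1) + expR (r * z2) = 2 * s1 ->
  s ^+ 2 * (expR z1 + expR z2) <= 2 * s ^+ 2 + 2 * s' ^+ 2 * (s' - 1) ->
  s1 <= s'.
Proof.
move=> s_ge1 ss' s10 r01 rs e_s h.
rewrite leNgt; apply/negP => lt.
have := expR_chord _ _ z1 r01; have := expR_chord _ _ z2 r01.
move: (expR z1) (expR z2) (expR _) (expR _) e_s h => E1 E2 F1 F2 e_s h h2 h1.
have h3 : 2 * s1 - 2 <= r * (E1 + E2 - 2) by clear -e_s h1 h2; lra.
have s20 : 0 <= s1 ^+ 2 by exact: sqr_ge0.
have := ler_wpM2l s20 h3; rewrite mulrA [s1 ^+ 2 * r]mulrC rs => h4.
(* The map [q -> q^2 (q - 1)] is strictly increasing for [q >= 1], so this contradicts [s' < s1]. *)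
have h5 : s1 ^+ 2 * (s1 - 1) <= s' ^+ 2 * (s' - 1) by clear -h h4; lra.
have h6 : s' ^+ 2 * (s1 - 1) <= s1 ^+ 2 * (s1 - 1).
  apply: ler_wpM2r; first by clear -s_ge1 ss' lt; lra.
  by rewrite ler_pXn2r ?nnegrE//; clear -s_ge1 ss' lt; lra.
have h7 : s' ^+ 2 * (s' - 1) < s' ^+ 2 * (s1 - 1).
  have s'0 : 0 < s' ^+ 2 by apply: exprn_gt0; clear -s_ge1 ss'; lra.
  by rewrite ltr_pM2l//; clear -lt; lra.
by have := lt_le_trans h7 (le_trans h6 h5); rewrite ltxx.
Qed.

Lemma CP_run_pair_time (R : realType) (B t0 : R) (p l x : nat -> 'I_2 -> R)
    (t V : nat -> R) : 0 < t0 -> 3584 * B ^+ 2 * ln 2 <= t0 ->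
  CP_run (@phiNH R) (@proj_nonneg R) B t0 p l x t V -> forall j,
  V j / t0 <= 1 / 4 ->
  Num.sqrt (t j / t0) <= 1 + V j / t0 / 2 + (V j / t0) ^+ 2 / 16.
Proof.
move=> t00 Bt0 run.
have time := CP_run_time _ _ _ _ _ _ _ _ _ (isT : (1 < 2)%N) t00 Bt0 run.
have pot := CP_run_potential _ _ _ _ _ _ _ _ _ t00 run.
have t0n : t0 != 0 by rewrite gt_eqF.
have ti0 : 0 <= t0^-1 by rewrite invr_ge0 ltW.
elim=> [|j IH] Vj.
  have [_ -> -> _] := run.
  by rewrite divff// sqrtr1 !mul0r expr0n /= mul0r !addr0.
have [tj pj] := pot j; have [tj1 pj1] := pot j.+1.
have tp : 0 < t j by exact: lt_le_trans tj.
have tp1 : 0 < t j.+1 by exact: lt_le_trans tj1.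
have [DB S1 S2 hX /andP[d0 d1]] := CP_run_step _ _ _ _ _ _ _ _ _ j (isT : (0 < 2)%N) tp run.
have [b1 b2 [V0 _]] := time j.
(* The budget at round 0 bounds the increment of [V] in units of [t0] rather than of [t j]. *)
have [B0 _ _] := time 0%N; rewrite (_ : t 0%N = t0) in B0; last by have [] := run.
have [_ _ _ /(_ j) [_ _ _ [tt _] _]] := run.
have VV : V j.+1 / t0 = V j / t0 + (V j.+1 - V j) / t0 by field.
have d0' : 0 <= (V j.+1 - V j) / t0 by exact: mulr_ge0.
have d1' : (V j.+1 - V j) / t0 <= 1 / 2000.
  by apply: le_trans B0; exact: ler_wpM2r.
have v0 : 0 <= V j / t0 by exact: mulr_ge0.
have dE : t0 * ((V j.+1 - V j) / t0) = V j.+1 - V j by field.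
rewrite VV in Vj *.
move: IH Vj d0' d1' v0 dE; move: ((V j.+1 - V j) / t0) (V j / t0) => d v IH Vj d0' d1' v0 dE.
clear VV B0.
have v1 : v <= 1 / 4 by clear -Vj d0'; lra.
have sg := IH v1.
have s0 : 0 <= t j / t0 by rewrite divr_ge0 ?ltW.
have s1 : 1 <= Num.sqrt (t j / t0).
  by rewrite -[X in X <= _]sqrtr1; apply: ler_wsqrtr; rewrite ler_pdivlMr// mul1r.
have q0 : 0 < t j.+1 / t0 by rewrite divr_gt0.
have sE := sqr_sqrtr s0; have qE := sqr_sqrtr (ltW q0).
have qp : 0 < Num.sqrt (t j.+1 / t0) by rewrite sqrtr_gt0.
move: pj pj1 sg s1 sE qE qp.
move: (Num.sqrt (t j / t0)) (Num.sqrt (t j.+1 / t0)) => s q pj pj1 sg s1 sE qE qp.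
have s2 : s <= 113 / 100.
  have : v ^+ 2 <= v * (1 / 4) by rewrite expr2; apply: ler_wpM2l.
  clear -sg v0 v1; lra.
apply: (@le_trans _ _ (s + d / 2 + (2 * v * d + d ^+ 2) / 16)); last first.
  clear -sg; lra.
have vd0 : 0 <= v * d by exact: mulr_ge0.
have dd0 : 0 <= d ^+ 2 by exact: sqr_ge0.
have r1 : t j / t j.+1 <= 1 by rewrite ler_pdivrMr// mul1r.
have r0 : 0 <= t j / t j.+1 by rewrite divr_ge0 ?ltW.
have tn : t j != 0 by rewrite gt_eqF.
have tn1 : t j.+1 != 0 by rewrite gt_eqF.
have rz (Y : R) : Y ^+ 2 / (2 * t j.+1) = t j / t j.+1 * (Y ^+ 2 / (2 * t j)).
  by field; rewrite tn tn1.
rewrite !big_ord_recl !big_ord0 !addr0 !rz in pj pj1.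
apply: (pair_next _ s q _ (t j / t j.+1) _ _ s1 _ qp _ _ pj1).
- by clear -d0' vd0 dd0; lra.
- by rewrite r0.
- by rewrite qE sE; field; rewrite t0n tn1.
have hs : 1 <= s <= 113 / 100 by rewrite s1.
have hd : 0 <= d <= 1 / 2000 by rewrite d0'.
have hsg : 1 <= s <= 1 + v / 2 + v ^+ 2 / 16 by rewrite s1.
have hv : 0 <= v <= 1 / 4 by rewrite v0.
apply: le_trans (pair_time_step _ _ _ _ _ hsg hv hd (erefl _)).
have DB2 i : (x j.+1 i - x j i) ^+ 2 / t j <= B ^+ 2 / t j.
  apply: ler_wpM2r; first by rewrite invr_ge0 ltW.
  rewrite -(real_normK (num_real (x j.+1 i - x j i))).
  by rewrite ler_pXn2r ?nnegrE//; apply: le_trans (DB i).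
have c0 i : 0 <= proj_nonneg (x j i) ^+ 2 / t j by rewrite divr_ge0 ?sqr_ge0 ?(ltW tp).
have sn : (Num.sqrt (t j))^-1 != 0 by rewrite invr_eq0 gt_eqF ?sqrtr_gt0.
have hw i : (x j.+1 i - x j i) ^+ 2 / t j <= 1 / 2000 := le_trans (DB2 i) b1.
have hcw i : proj_nonneg (x j i) ^+ 2 / t j * ((x j.+1 i - x j i) ^+ 2 / t j) <= 1 / 1200 :=
  le_trans (ler_wpM2l (c0 i) (DB2 i)) (b2 i).
rewrite !big_ord_recl !big_ord0 !addr0 /phiNH in S1 S2.
have S1' : expR (proj_nonneg (x j ord0) ^+ 2 / (2 * t j)) *
    (proj_nonneg (x j ord0) * (x j.+1 ord0 - x j ord0)) +
  expR (proj_nonneg (x j (lift ord0 ord0)) ^+ 2 / (2 * t j)) *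
    (proj_nonneg (x j (lift ord0 ord0)) * (x j.+1 (lift ord0 ord0) - x j (lift ord0 ord0))) = 0.
  by apply: (mulfI sn); rewrite mulr0 -[RHS]S1; ring.
have tE : t j = t0 * s ^+ 2 by rewrite sE; field.
have e_mono i : expR (proj_nonneg (x j.+1 i) ^+ 2 / (2 * t j)) <=
    expR ((proj_nonneg (x j i) + (x j.+1 i - x j i)) ^+ 2 / (2 * t j)).
  rewrite ler_expR; apply: ler_wpM2r; first by rewrite invr_ge0 mulr_ge0 ?(ltW tp).
  have /andP[h1 h2] := hX i.
  by rewrite -[X in _ <= X](real_normK (num_real _)) ler_pXn2r ?nnegrE.
apply: le_trans (pair_potential_step _ _ _ (t j) _ _ _ _ tp hs hd (hw ord0) (hw (lift ord0 ord0))
  (hcw ord0) (hcw (lift ord0 ord0)) pj S1' _).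
  by apply: ler_wpM2l; [exact: sqr_ge0|exact: lerD].
have st : s ^+ 2 * t0 = t j by rewrite sE; field.
apply: (mulfI sn); apply: (mulfI t0n).
move: S2; rewrite -dE => S2.
have mulE (A C : R) : A = C -> s ^+ 2 * t0 * A = t j * C by move=> ->; rewrite st.
move: (mulE _ _ S2).
move: (expR (proj_nonneg (x j ord0) ^+ 2 / (2 * t j)))
  (expR (proj_nonneg (x j (lift ord0 ord0)) ^+ 2 / (2 * t j))) => e1 e2 S3.
apply: (eq_trans _ (eq_trans S3 _)); ring.
Qed.

(** * From a run to the quantile regret *)

Lemma kth_largest_single (R : realType) (v : 'I_1 -> R) (k : nat) :
  (forall i, v i = 0) -> kth_largest k v = 0.
Proof.
move=> v0; rewrite /kth_largest.
set s := sort _ _.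
have : all (pred1 0) s.
  rewrite (perm_all _ (permEl (perm_sort _ _))) all_map.
  by apply/allP => i _ /=; rewrite v0.
move=> /(all_nthP 0) h.
have [ks|ks] := ltnP k.-1 (size s); last by rewrite nth_default.
by apply/eqP; exact: h.
Qed.

(** For one expert [ln N = 0], so [t0 = 1] gives no control over [B]; but the play is forced and the
    regret stays 0. *)
Lemma CP_run_single (R : realType) phi proj (B t0 : R) (p l x : nat -> 'I_1 -> R)
    (t V : nat -> R) : CP_run phi proj B t0 p l x t V -> forall j i, x j i = 0.
Proof.
move=> [x0 _ _ run]; elim=> [|j IH] i; first exact: x0.
have [[[_ p1] _] _ -> _ _] := run j.
rewrite IH add0r big_ord1; rewrite big_ord1 in p1.
by rewrite p1 mul1r (ord1 i) subrr.
Qed.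

Lemma kth_largest_potential (R : realType) (N k : nat) (v : 'I_N -> R) (t s : R) :
  (k.-1 < N)%N -> 0 < t -> 0 < kth_largest k v ->
  \sum_(i < N) expR (proj_nonneg (v i) ^+ 2 / (2 * t)) = N%:R * s ->
  kth_largest k v ^+ 2 / (2 * t) <= ln (1 + N%:R / k.-1.+1%:R * (s - 1)).
Proof.
move=> kN t0 v0 S.
have z0 (y : R) : 0 <= y ^+ 2 / (2 * t) by rewrite divr_ge0 ?sqr_ge0 ?mulr_ge0 ?(ltW t0).
have e1 (y : R) : 1 <= expR (y ^+ 2 / (2 * t)) by rewrite -[X in X <= _]expR0 ler_expR.
have := kth_largest_sum_le _ _ _ v (fun i => expR (proj_nonneg (v i) ^+ 2 / (2 * t))) 1
  (expR (kth_largest k v ^+ 2 / (2 * t))) kN (e1 _) (fun i => e1 _).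
rewrite S => h.
have {}h : k.-1.+1%:R * (expR (kth_largest k v ^+ 2 / (2 * t)) - 1) + N%:R * 1 <= N%:R * s.
  apply: h => i vi; rewrite ler_expR; apply: ler_wpM2r.
    by rewrite invr_ge0 mulr_ge0 ?(ltW t0).
  have vp : kth_largest k v <= proj_nonneg (v i) by apply: (le_trans vi); rewrite le_max lexx.
  by rewrite ler_pXn2r ?nnegrE ?(ltW v0)//; apply: le_trans vp; exact: ltW.
have k0 : 0 < k.-1.+1%:R :> R by rewrite ltr0n.
have {}h : expR (kth_largest k v ^+ 2 / (2 * t)) <= 1 + N%:R / k.-1.+1%:R * (s - 1).
  rewrite -lerBlDl [X in _ <= X]mulrAC ler_pdivlMr// mulrC.
  by clear -h; lra.
rewrite -[X in X <= _]expRK ler_ln ?posrE ?expR_gt0//.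
exact: lt_le_trans (expR_gt0 _) h.
Qed.

Lemma CP_run_log_bound (R : realType) (N k : nat) (B t0 : R) (p l x : nat -> 'I_N -> R)
    (t V : nat -> R) (j : nat) (eps : R) :
  (1 < N)%N -> 0 < t0 -> 3584 * B ^+ 2 * ln N%:R <= t0 ->
  CP_run (@phiNH R) (@proj_nonneg R) B t0 p l x t V ->
  (k < N)%N -> 0 < eps -> N%:R * eps < k.+1%:R ->
  t j / t0 * ln (1 + N%:R / k.-1.+1%:R * (Num.sqrt (t j / t0) - 1)) <=
   (1 + 2 * (V j / t0)) * ln (1 / eps) + (1 + 2 * (V j / t0)) / 2 * ln (1 + 2 * (V j / t0)).
Proof.
move=> N1 t00 Bt0 run kN eps0 kE.
have [_ _ [V0 tV]] := CP_run_time _ _ _ _ _ _ _ _ _ N1 t00 Bt0 run j.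
have [tj _] := CP_run_potential _ _ _ _ _ _ _ _ _ t00 run j.
have s0 : 0 <= t j / t0 by rewrite divr_ge0 ?ltW//; exact: lt_le_trans tj.
have s1 : 1 <= Num.sqrt (t j / t0).
  by rewrite -[X in X <= _]sqrtr1; apply: ler_wsqrtr; rewrite ler_pdivlMr// mul1r.
have sE := sqr_sqrtr s0.
have v0 : 0 <= V j / t0 by rewrite divr_ge0// ltW.
have sv : Num.sqrt (t j / t0) ^+ 2 <= 1 + 11 / 10 * (V j / t0).
  by rewrite sE ler_pdivrMr// mulrDl mul1r mulrA mulfVK// gt_eqF.
have small : N = 2%N -> V j / t0 <= 1 / 4 ->
    Num.sqrt (t j / t0) <= 1 + V j / t0 / 2 + (V j / t0) ^+ 2 / 16.
  move=> N2; subst N; exact: (CP_run_pair_time _ _ _ _ _ _ _ _ t00 Bt0 run j).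
rewrite -{1}sE; clear sE s0 tV tj.
move: v0 s1 sv small; move: (V j / t0) (Num.sqrt (t j / t0)) => v s v0 s1 sv small.
clear run V0 Bt0 x t V p l j B.
have N2 : 2 <= N%:R :> R by rewrite ler_nat.
have T0 : 0 <= 1 + 2 * v by clear -v0; lra.
have k10 : 0 < k.+1%:R :> R by rewrite ltr0n.
have m_le m : 0 < m -> m <= 1 / eps -> (1 + 2 * v) * ln m <= (1 + 2 * v) * ln (1 / eps).
  move=> m0 me; apply: ler_wpM2l => //; rewrite ler_ln ?posrE//.
  exact: lt_le_trans me.
have me : N%:R / k.+1%:R <= 1 / eps.
  by rewrite ler_pdivlMr// mulrAC ler_pdivrMr// mul1r ltW.
have mp : 0 < N%:R / k.+1%:R :> R by rewrite divr_gt0//; clear -N2; lra.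
(* For [k = 0] the count [max k 1] equals [k + 1], so rounding loses nothing. For [k = 1] the case
   [N = 2] is split off, and it alone uses [small]. *)
case: k kN kE k10 me mp => [|[|k]] kN kE k10 me mp.
- rewrite /= divr1 in me mp *.
  apply: (@le_trans _ _ (s ^+ 2 * ln (N%:R * s))).
    apply: ler_wpM2l; first exact: sqr_ge0.
    rewrite ler_ln ?posrE; [clear -N2; lra| | ].
    + by have : 0 <= N%:R * (s - 1); [apply: mulr_ge0; [clear -N2|clear -s1]|clear]; lra.
    + by apply: mulr_gt0; [clear -N2|clear -s1]; lra.
  apply: (@le_trans _ _ ((1 + 2 * v) * ln N%:R + (1 + 2 * v) / 2 * ln (1 + 2 * v))).
    have sT : s ^+ 2 <= 1 + 2 * v by clear -sv v0; lra.
    apply: log_target => //; [clear -N2; lra|clear -s1; lra|].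
    have s20 : 1 <= s ^+ 2 by clear -s1; nra.
    by apply: ler_pM => //; clear -s20 sT; lra.
  by rewrite lerD2r; exact: m_le.
- have := m_le _ mp me; rewrite /= => mm.
  have [N3|N3] := ltnP 2 N.
    have N3' : 3 <= N%:R :> R by rewrite ler_nat.
    have := log_regret_many _ s v 1 N%:R s1 v0 sv (lexx 1) (fun _ => erefl).
    have -> : 1 + 1 = 2 :> R by ring.
    move=> h; apply: le_trans (h N2 N3') _.
    by rewrite lerD2r.
  have NE : N = 2%N by apply/eqP; rewrite eqn_leq N3.
  subst N; rewrite divff// ln1 mulr0 in mm.
  have := log_regret_pair _ s v s1 v0 sv (small erefl).
  have -> : 1 + 2%:R / 1%:R * (s - 1) = 2 * s - 1 by field.
  by move=> h; apply: (le_trans h); rewrite lerDr.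
- have K1 : 2 <= k.+2%:R :> R by rewrite ler_nat.
  have N3' : 3 <= N%:R :> R by rewrite ler_nat; apply: leq_trans kN.
  have KE : k.+2%:R + 1 = k.+3%:R :> R by rewrite natr1.
  have := log_regret_many _ s v k.+2%:R N%:R s1 v0 sv.
  rewrite KE => h; apply: le_trans (h _ _ _ N3') _.
  + by clear -K1; lra.
  + by clear -K1; lra.
  + by rewrite ler_nat.
  + by rewrite lerD2r; exact: m_le.
Qed.

Theorem theorem4p2 (R : realType) (N : nat) (B : R) :
  (0 < N)%N -> 0 < B ->
  let t0 := Num.max (512 * expR 1 ^+ 2 * B ^+ 2 * ln (N%:R : R)) 1 in
  forall (p l x : nat -> 'I_N -> R) (t V : nat -> R),
    CP_run (@phiNH R) (@proj_nonneg R) B t0 p l x t V ->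
    forall (eps : R) (T : nat), 0 < eps < 1 -> (1 <= T)%N ->
      regret_eps x T eps
      <= Num.sqrt ((t0 + 2 * V T) * (ln (t0 + 2 * V T) + 2 * ln (1 / eps))).
Proof.
move=> N0 B0 t0 p l x t V run eps T /andP[eps0 eps1] _.
have t01 : 1 <= t0 by rewrite /t0 le_max lexx orbT.
have t0b : 512 * expR 1 ^+ 2 * B ^+ 2 * ln (N%:R : R) <= t0 by rewrite /t0 le_max lexx.
rewrite /regret_eps.
have Ne0 : 0 <= N%:R * eps by rewrite mulr_ge0// ltW.
have fl0 : 0 <= Num.floor (N%:R * eps) by rewrite floor_ge0.
have /andP[kl ku] := floor_itv (N%:R * eps).
have kE : `|Num.floor (N%:R * eps)|%N%:R = (Num.floor (N%:R * eps))%:~R :> R.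
  by rewrite natr_absz ger0_norm.
rewrite intrD -kE in ku; rewrite -kE in kl.
move: (`|Num.floor _|%N) kl ku => k kl ku; clear kE fl0 Ne0.
have [v0|v0] := leP (kth_largest k (x T)) 0; first by apply: (le_trans v0); exact: sqrtr_ge0.
have [N1|N1] := ltnP 1 N; last first.
  have NE : N = 1%N by apply/eqP; rewrite eqn_leq N1.
  subst N; move: v0; rewrite kth_largest_single ?ltxx//.
  exact: (CP_run_single _ _ _ _ _ _ _ _ _ _ run T).
move: t0 t01 t0b run => t0 t01 t0b run.
have t00 : 0 < t0 by clear -t01; lra.
have kN : (k < N)%N.
  rewrite -(ltr_nat R); apply: (le_lt_trans kl).
  by rewrite -[X in _ < X]mulr1 ltr_pM2l// ltr0n.
(* [3584 = 512 * 7] and [e^2 >= 7]. *)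
have Bt0 : 3584 * B ^+ 2 * ln N%:R <= t0.
  apply: le_trans t0b; apply: ler_wpM2r; first by apply: ln_ge0; rewrite ler1n.
  apply: ler_wpM2r; first exact: sqr_ge0.
  have := expR1_sqr_ge R; clear; lra.
rewrite natr1 in ku.
have L := CP_run_log_bound _ _ _ _ _ _ _ _ _ _ T _ N1 t00 Bt0 run kN eps0 ku.
have [tT pT] := CP_run_potential _ _ _ _ _ _ _ _ _ t00 run T.
have tp : 0 < t T by exact: lt_le_trans tT.
have [_ _ [V0 _]] := CP_run_time _ _ _ _ _ _ _ _ _ N1 t00 Bt0 run T.
have h := kth_largest_potential _ _ _ _ _ _ (leq_ltn_trans (leq_pred k) kN) tp v0 pT.
rewrite -[X in X <= _]ger0_norm ?(ltW v0)// -sqrtr_sqr; apply: ler_wsqrtr.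
have TE : t0 + 2 * V T = t0 * (1 + 2 * (V T / t0)) by field; rewrite gt_eqF.
have W0 : 0 <= V T / t0 by rewrite divr_ge0// ltW.
(* This is where [t0 >= 1] enters: it lets the bound in units of [t0] imply the unscaled one. *)
have hln : ln (1 + 2 * (V T / t0)) <= ln (t0 + 2 * V T).
  rewrite TE ler_ln ?posrE; [|clear -W0; lra|by apply: mulr_gt0 => //; clear -W0; lra].
  by rewrite -[X in X <= _]mul1r; apply: ler_wpM2r => //; clear -W0; lra.
have T0 : 0 <= t0 + 2 * V T by clear -t00 V0; lra.
apply: (@le_trans _ _ ((t0 + 2 * V T) * (ln (1 + 2 * (V T / t0)) + 2 * ln (1 / eps)))); last first.
  by apply: ler_wpM2l => //; rewrite lerD2r.
rewrite ler_pdivrMr ?mulr_gt0// in h; apply: (le_trans h).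
have := ler_wpM2l (ltW t00) L.
have -> X : t0 * (t T / t0 * X) = t T * X by field; rewrite gt_eqF.
rewrite TE; clear; lra.
Qed.
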